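(* Let $K$ be a field of characteristic $p>0$, let $n\geq 1$, let $X$ be a $(2n+1)\times(2n+1)$ skew-symmetric matrix of indeterminates, and let $I=\operatorname{Pf}_{2n}(X)$ be the ideal of submaximal pfaffians in $K[X]$. Then for every integer $k\geq 0$, $$\operatorname{fpt}(L_k(I))=3.$$ In particular, $\operatorname{fpt}(I)=3$.
   Context: A skew-symmetric matrix of indeterminates has $x_{i,i}=0$, $x_{j,i}=-x_{i,j}$, and the $x_{i,j}$ with $i<j$ algebraically independent; $K[X]$ is the polynomial ring in these variables. $\operatorname{Pf}_{2n}(X)$ is the ideal generated by the pfaffians of the $2n\times 2n$ principal submatrices. Generic link: let $I$ be an unmixed ideal of height $g>0$ in a polynomial ring $R$ with generating set $f_1,\ldots,f_r$, let $Y$ be a $g\times r$ matrix of indeterminates, and let $\mathfrak{a}$ be the ideal of $R[Y]$ generated by the entries of $Y[f_1\cdots f_r]^T$. The generic link is $L_1(I)=\mathfrak{a}R[Y]:IR[Y]$. Iterating, $L_0(I)=I$ and $L_k(I)=L_1(L_{k-1}(I))$ for $k>0$, an ideal in a polynomial extension of $R$, called the $k$-th generic link; homogeneous generating sets are used at each stage. Different generating sets yield equivalent generic links (equal under an isomorphism of ambient rings after adjoining finitely many variables to each). $F$-pure threshold: for a polynomial ring over a field of characteristic $p>0$ with homogeneous maximal ideal $\mathfrak{m}$ (generated by all the variables) and a proper homogeneous ideal $I$, set $\nu_I(p^e)=\max\{r\in\mathbb{N}: I^r\not\subseteq\mathfrak{m}^{[p^e]}\}$, where $\mathfrak{m}^{[p^e]}=(a^{p^e}: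 a\in\mathfrak{m})$, and $\operatorname{fpt}(I)=\lim_{e\to\infty}\nu_I(p^e)/p^e$. *)

(* Defs.v *)
From HB Require Import structures.
From mathcomp Require Import all_boot all_order all_fingroup all_algebra.
(* [mpoly] has to be loaded before the analysis files: their notations cannot
   be declared in the other order. *)
From mathcomp Require Import mpoly.
From mathcomp Require Import boolp classical_sets reals topology normedtype.
From mathcomp Require Import sequences.

Set Implicit Arguments.
Unset Strict Implicit.
Unset Printing Implicit Defensive.

Import Order.TTheory GRing.Theory Num.Theory.
Import numFieldNormedType.Exports.

Local Open Scope classical_set_scope.
Local Open Scope ring_scope.

Section Ideals.
Variable A : comNzRingType.
Implicit Types (S I J P : set A).

Definition ideal_gen S : set A :=
  [set x | exists r (a b : 'I_r -> A),
     (forall i, S (b i)) /\ x = \sum_(i < r) a i * b i].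

(* For r = 0 the empty product gives the unit ideal. *)
Definition ideal_exp I (r : nat) : set A :=
  ideal_gen [set x | exists f : 'I_r -> A,
                       (forall i, I (f i)) /\ x = \prod_(i < r) f i].

Definition frobenius_power I (q : nat) : set A :=
  ideal_gen [set a ^+ q | a in I].

Definition ideal_colon I J : set A := [set x | forall y, J y -> I (x * y)].

(* [idealr_closed] includes properness. *)
Definition prime_ideal P : Prop :=
  idealr_closed [pred x in P] /\ prime_idealr_closed [pred x in P].

Definition prime_chain (h : nat) P : Prop :=
  exists c : nat -> set A,
    [/\ forall i, (i <= h)%N -> prime_ideal (c i),
        forall i, (i < h)%N -> c i `<` c i.+1
      & c h = P].

Definition has_prime_height P (h : nat) : Prop :=
  prime_chain h P /\ forall h', prime_chain h' P -> (h' <= h)%N.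

Definition has_height I (g : nat) : Prop :=
  (exists P, [/\ prime_ideal P, I `<=` P & has_prime_height P g]) /\
  forall P h, prime_ideal P -> I `<=` P -> has_prime_height P h -> (g <= h)%N.

End Ideals.

Section Pfaffians.
Variable A : comNzRingType.

Fact even_ord_subproof t (i : 'I_t) : (i.*2 < t.*2)%N.
Proof. by rewrite ltn_double. Qed.

Fact odd_ord_subproof t (i : 'I_t) : (i.*2.+1 < t.*2)%N.
Proof. by rewrite ltn_Sdouble. Qed.

Definition even_ord t (i : 'I_t) : 'I_(t.*2) := Ordinal (even_ord_subproof i).
Definition odd_ord t (i : 'I_t) : 'I_(t.*2) := Ordinal (odd_ord_subproof i).

(* Each perfect matching of the indices, written {i_1 < j_1}, ..., {i_t < j_t}
   with i_1 < ... < i_t, is represented by the permutation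
   (i_1, j_1, ..., i_t, j_t). *)
Definition matching_perm t (s : 'S_(t.*2)) : bool :=
  [forall i : 'I_t, (s (even_ord i) < s (odd_ord i))%N] &&
  [forall i : 'I_t, forall j : 'I_t,
     (i < j)%N ==> (s (even_ord i) < s (even_ord j))%N].

Definition pfaffian t (M : 'M[A]_(t.*2)) : A :=
  \sum_(s : 'S_(t.*2) | matching_perm s)
    (-1) ^+ s * \prod_(i < t) M (s (even_ord i)) (s (odd_ord i)).

(* The ideal Pf_{2t}(M). *)
Definition pfaffian_ideal m (M : 'M[A]_m) (t : nat) : set A :=
  ideal_gen [set x | exists f : 'I_(t.*2) -> 'I_m,
                       {homo f : i j / (i < j)%N} /\
                       x = pfaffian (mxsub f f M)].

End Pfaffians.

Section SkewMatrix.
Variables (K : fieldType) (m : nat).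

Definition skew_index : finType := {ij : 'I_m * 'I_m | (ij.1 < ij.2)%N}.

(* The variable x_{i,j} if i < j, and 0 otherwise. *)
Definition skew_var (i j : 'I_m) : {mpoly K[#|skew_index|]} :=
  oapp (fun ij : skew_index => 'X_(enum_rank ij)) 0 (insub (i, j)).

Definition skew_mx : 'M[{mpoly K[#|skew_index|]}]_m :=
  \matrix_(i, j) (skew_var i j - skew_var j i).

End SkewMatrix.

Section GenericLink.
Variable K : fieldType.

Definition extend_vars N M (x : {mpoly K[N]}) : {mpoly K[N + M]} :=
  x \mPo [tuple 'X_(lshift M i) | i < N].

Definition indet_mx N g r : 'M[{mpoly K[N + g * r]}]_(g, r) :=
  \matrix_(i, j) 'X_(rshift N (mxvec_index i j)).

Definition link_gens N g r (f : 'cV[{mpoly K[N]}]_r) :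
    'cV[{mpoly K[N + g * r]}]_g :=
  indet_mx N g r *m map_mx (extend_vars (g * r)) f.

Definition generic_link N g r (f : 'cV[{mpoly K[N]}]_r) :
    set {mpoly K[N + g * r]} :=
  ideal_colon (ideal_gen (range (fun i => link_gens g f i 0)))
    (ideal_gen (extend_vars (g * r) @` ideal_gen (range (fun j => f j 0)))).

(* [iterated_link I k wt J]: J is a k-th generic link of I, formed with
   generating sets that are homogeneous for the grading [wt] reached at each
   stage.  The polynomial ring of I has its standard grading.  The entries of
   Y f are not homogeneous for the standard grading when the f_j have different
   degrees, so the new variables may have any positive weights that make these
   entries, and therefore the link, homogeneous. *)
Inductive iterated_link N0 (I : set {mpoly K[N0]}) :
    nat -> forall N, measure N -> set {mpoly K[N]} -> Prop :=
| iterated_link0 : @iterated_link N0 I 0 N0 mdeg I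
| iterated_linkS k N (wt : measure N) (J : set {mpoly K[N]}) g r
    (f : 'cV[{mpoly K[N]}]_r) (wt' : measure (N + g * r)) :
    @iterated_link N0 I k N wt J ->
    has_height J g ->
    J = ideal_gen (range (fun j => f j 0)) ->
    (forall j, f j 0 \is homog wt) ->
    (forall i, wt' U_(lshift (g * r) i)%MM = wt U_(i)%MM) ->
    (forall v, (0 < wt' U_(v)%MM)%N) ->
    (forall i, link_gens g f i 0 \is homog wt') ->
    @iterated_link N0 I k.+1 (N + g * r) wt' (@generic_link N g r f).

End GenericLink.

Section FPureThreshold.
Variables (K : fieldType) (N : nat).

Definition max_ideal : set {mpoly K[N]} := ideal_gen (range (fun i => 'X_i)).

Definition is_nu (J : set {mpoly K[N]}) (q v : nat) : Prop :=
  ~ (ideal_exp J v `<=` frobenius_power max_ideal q) /\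
  forall r, ~ (ideal_exp J r `<=` frobenius_power max_ideal q) -> (r <= v)%N.

(* The maxima nu exist, and the limit exists and equals c. *)
Definition has_fpt (R : realType) (p : nat) (J : set {mpoly K[N]}) (c : R) :
    Prop :=
  exists nu : nat -> nat,
    (forall e, is_nu J (p ^ e) (nu e)) /\
    (fun e => (nu e)%:R / (p ^ e)%:R : R) @ \oo --> c.

End FPureThreshold.

(* Main.v *)
(* Upper bound.  For a generic link L of J, formed with three generators
   alpha_i of the linked complete intersection, any nonzero f in J satisfies
   f L <= (alpha_1, alpha_2, alpha_3) <= (Y).  As f does not lie in the prime
   (Y), every power L^M with M > 3(q - 1) lies in m^[q].  The ideal I has the
   same shape: a pfaffian s of size 2n-2 on an index set A multiplies I into the
   ideal of the three submaximal pfaffians containing A, because the vector of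
   signed submaximal pfaffians is in the kernel of X.

   Lower bound.  We carry three elements h_i of J with
   (h_1 h_2 h_3)^(q-1) not in m^[q].  For I take the pfaffians deleting the
   first, the middle and the last index; splitting off the corner variables
   reduces n to n-1.  For a link take the alpha_i: if (alpha_1 alpha_2
   alpha_3)^(q-1), which has degree < q in each variable of Y, were in m^[q], it
   would stay there after specializing Y so that alpha_i becomes h_i.

   Height.  Every link in the chain uses exactly three alpha_i because all these
   ideals have height 3.  Both bounds rest on eliminating three variables v_i
   from equations s v_i + r_i with s, r_i free of the v_i: these give a chain of
   primes below any prime containing them but not s, and a prime modulo which
   all but three variables are algebraically independent. *)
Require Import Defs.
From HB Require Import structures.
From mathcomp Require Import all_boot all_order all_fingroup all_algebra.
From mathcomp Require Import mpoly ring zify.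
From mathcomp Require Import boolp classical_sets reals topology normedtype.
From mathcomp Require Import sequences.

Set Implicit Arguments.
Unset Strict Implicit.
Unset Printing Implicit Defensive.

Import Order.TTheory GRing.Theory Num.Theory.
Import numFieldNormedType.Exports.

Local Open Scope classical_set_scope.
Local Open Scope ring_scope.

(** * Ideals and Frobenius powers *)

Section Ideals.
Variable A : comNzRingType.
Implicit Types (S I J P : set A).

Definition is_ideal I : Prop :=
  [/\ I 0, forall x y, I x -> I y -> I (x + y) & forall a x, I x -> I (a * x)].

Lemma prime_idealP P : prime_ideal P <->
  [/\ is_ideal P, ~ P 1 & forall x y, P (x * y) -> P x \/ P y].
Proof.
split=> [[[P0 P1 PD] PM]|[[P0 PD PZ] P1 PM]].
  move: P0 P1 PD PM; rewrite /prime_idealr_closed !inE => P0 P1 PD PM.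
  have PD' a u v : P u -> P v -> P (a * u + v).
    by move=> Pu Pv; have := PD a u v; rewrite !inE; apply.
  split; first split=> //.
  - by move=> x y Px Py; rewrite -[x]mul1r; apply: PD'.
  - by move=> a x Px; rewrite -[_ * _]addr0; apply: PD'.
  - by move=> P1'; move/negP: P1; apply; rewrite inE.
  - move=> x y Pxy; have := PM x y; rewrite !inE => /(_ Pxy) /orP[] /set_mem; by [left|right].
split; first split.
- by rewrite !inE.
- by apply/negP; rewrite !inE.
- by move=> a u v; rewrite !inE => Pu Pv; apply: PD => //; apply: PZ.
- move=> u v; rewrite !inE => /PM[] Pu; apply/orP; [left|right]; exact: mem_set.
Qed.

Lemma ideal_sum I (T : Type) (r : seq T) (Q : pred T) (F : T -> A) :
  is_ideal I -> (forall i, Q i -> I (F i)) -> I (\sum_(i <- r | Q i) F i).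
Proof. by case=> I0 ID _ IF; apply: (big_ind I). Qed.

Lemma idealN I x : is_ideal I -> I x -> I (- x).
Proof. by case=> _ _ IM Ix; rewrite -mulN1r; apply: IM. Qed.

Lemma idealB I x y : is_ideal I -> I x -> I y -> I (x - y).
Proof. by move=> II Ix Iy; case: (II) => _ ID _; apply: ID => //; apply: idealN. Qed.

Lemma ideal_mulr I a x : is_ideal I -> I x -> I (x * a).
Proof. by case=> _ _ IM Ix; rewrite mulrC; apply: IM. Qed.

Lemma ideal_gen_ideal S : is_ideal (ideal_gen S).
Proof.
split.
- by exists 0, (fun=> 0), (fun=> 0); split; [case|rewrite big_ord0].
- move=> _ _ [r [a [b [Sb ->]]]] [r' [a' [b' [Sb' ->]]]].
  exists (r + r')%N, (fun i => match split i with inl i => a i | inr i => a' i end),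
    (fun i => match split i with inl i => b i | inr i => b' i end).
  split; first by move=> i; case: split.
  rewrite big_split_ord /=; congr (_ + _); apply: eq_bigr => i _.
    by rewrite (unsplitK (inl i)).
  by rewrite (unsplitK (inr i)).
- move=> c _ [r [a [b [Sb ->]]]]; exists r, (fun i => c * a i), b; split=> //.
  by rewrite mulr_sumr; apply: eq_bigr => i _; rewrite mulrA.
Qed.

Lemma sub_ideal_gen S : S `<=` ideal_gen S.
Proof. by move=> x Sx; exists 1%N, (fun=> 1), (fun=> x); rewrite big_ord1 mul1r. Qed.

Lemma ideal_gen_min S I : is_ideal I -> S `<=` I -> ideal_gen S `<=` I.
Proof.
move=> II SI _ [r [a [b [Sb ->]]]]; apply: ideal_sum => // i _.
by case: II => _ _; apply; apply/SI/Sb.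
Qed.

Lemma ideal_gen_range (r : nat) (f : 'I_r -> A) x :
  ideal_gen (range f) x -> exists b : 'I_r -> A, x = \sum_i b i * f i.
Proof.
move: x; apply: (@ideal_gen_min _ [set x | exists b : 'I_r -> A, x = \sum_i b i * f i]).
  split=> /=; last first.
  - move=> a _ [b ->]; exists (fun i => a * b i).
    by rewrite mulr_sumr; apply: eq_bigr => i _; rewrite mulrA.
  - move=> _ _ [b ->] [c ->]; exists (fun i => b i + c i).
    by rewrite -big_split; apply: eq_bigr => i _; rewrite mulrDl.
  - by exists (fun=> 0); rewrite big1 // => i _; rewrite mul0r.
move=> _ [i _ <-] /=; exists (fun j => (j == i)%:R).
rewrite (bigD1 i) //= eqxx mul1r big1 ?addr0 // => j /negPf->.
by rewrite mul0r.
Qed.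

Lemma prod_ideal_exp I (s : seq A) :
  (forall x, x \in s -> I x) -> ideal_exp I (size s) (\prod_(x <- s) x).
Proof.
move=> Is; apply: sub_ideal_gen; exists (fun i => s`_i); split.
  by move=> i; apply/Is/mem_nth.
by rewrite (big_nth 0) big_mkord.
Qed.

Lemma prime_exp P x n : prime_ideal P -> P (x ^+ n) -> P x.
Proof.
move=> /prime_idealP[_ P1 PM]; elim: n => [|n IHn]; first by rewrite expr0.
by rewrite exprS => /PM[].
Qed.

End Ideals.

Lemma ideal_preim (A B : comNzRingType) (f : {rmorphism A -> B}) (I : set B) :
  is_ideal I -> is_ideal [set x | I (f x)].
Proof.
case=> I0 ID IM; split=> /= [|x y Ix Iy|a x Ix].
- by rewrite rmorph0.
- by rewrite rmorphD; apply: ID.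
- by rewrite rmorphM; apply: IM.
Qed.

Lemma prime_preim (A B : comNzRingType) (f : {rmorphism A -> B}) (P : set B) :
  prime_ideal P -> prime_ideal [set x | P (f x)].
Proof.
move=> /prime_idealP[II P1 PM]; apply/prime_idealP; split=> /=.
- exact: ideal_preim.
- by rewrite rmorph1.
- by move=> x y; rewrite rmorphM => /PM.
Qed.

Lemma ker_prime (A : comNzRingType) (D : idomainType) (f : {rmorphism A -> D}) :
  prime_ideal [set x | f x = 0].
Proof.
apply: (@prime_preim A D f [set 0]); apply/prime_idealP; split=> [|/eqP|x y /eqP].
- by split=> [//|x y /= -> ->|a x /= ->]; rewrite ?addr0 ?mulr0.
- by rewrite oner_eq0.
- by rewrite mulf_eq0 => /orP[] /eqP; [left|right].
Qed.

Lemma mpoly_rmorph_ext n (R : comNzRingType) (T : nzRingType)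
    (f g : {rmorphism {mpoly R[n]} -> T}) :
  (forall c, f c%:MP = g c%:MP) -> (forall i, f 'X_i = g 'X_i) -> f =1 g.
Proof.
move=> fgC fgX x; rewrite [x]mpolyE !rmorph_sum; apply: eq_bigr => m _.
rewrite -mul_mpolyC !rmorphM fgC mpolyXE_id !rmorph_prod; congr (_ * _).
by apply: eq_bigr => i _; rewrite !rmorphXn fgX.
Qed.

Lemma mmap_var n (R : comNzRingType) (T : comNzRingType) (f : {rmorphism R -> T})
  (h : 'I_n -> T) i : mmap f h 'X_i = h i.
Proof. by rewrite mmapX mmap1U. Qed.

(** * Frobenius powers of the homogeneous maximal ideal as monomial ideals *)

Section Box.
Variables (K : comNzRingType) (N : nat).
Implicit Types (x y : {mpoly K[N]}) (q : nat).

(* Membership in the Frobenius power of the maximal ideal, read off monomials. *)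
Definition outbox q : set {mpoly K[N]} :=
  [set x | forall m, x@_m != 0 -> exists i, (q <= m i)%N].

Lemma outbox_ideal q : is_ideal (outbox q).
Proof.
split=> [m|x y Ox Oy m|a x Ox m].
- by rewrite mcoeff0 eqxx.
- rewrite mcoeffD; case: (eqVneq x@_m 0) => [->|/Ox//].
  by rewrite add0r => /Oy.
- rewrite -mcoeff_msupp => /msuppM_le /allpairsP[[m1 m2] /= [_ m2x ->]].
  have [|i qi] := Ox m2; first by rewrite -mcoeff_msupp.
  by exists i; rewrite mnmDE (leq_trans qi) ?leq_addl.
Qed.

Lemma outboxM q a x : outbox q x -> outbox q (a * x).
Proof. by case: (outbox_ideal q) => _ _; apply. Qed.

Lemma outboxXn q i : outbox q ('X_i ^+ q).
Proof.
move=> m; rewrite mpolyXn mcoeffX; case: (eqVneq _ m) => [<- _|_]; last by rewrite eqxx.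
by exists i; rewrite mulmnE mnm1E eqxx mul1n.
Qed.

Lemma outboxE q x (m : 'X_{1..N}) : outbox q x -> (forall i, m i < q)%N -> x@_m = 0.
Proof.
move=> Ox mq; apply/eqP/negPn/negP => /Ox[i]; by rewrite leqNgt mq.
Qed.

End Box.

Lemma expr_sum_pchar p e (R : comNzRingType) (T : Type) (r : seq T) (F : T -> R) :
  p \in [pchar R] -> (\sum_(i <- r) F i) ^+ (p ^ e) = \sum_(i <- r) F i ^+ (p ^ e).
Proof.
move=> hp; have pn : [pchar R].-nat (p ^ e)%N.
  by rewrite (eq_pnat _ (pcharf_eq hp)) pnatX pnat_id ?orTb //; case/andP: hp.
elim: r => [|a r IHr]; last first.
  by rewrite !big_cons -IHr (exprDn_pchar _ _ pn).
by rewrite !big_nil expr0n expn_eq0; case/andP: hp => /prime_gt0; case: p pn.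
Qed.

Lemma pchar_mpoly (R : comNzRingType) N p : p \in [pchar R] -> p \in [pchar {mpoly R[N]}].
Proof. exact: (rmorph_pchar (@mpolyC N R)). Qed.

(** With [q = p ^ e], the [q]-th power map is additive, so a power of [\sum_i b_i X_i] is a
    combination of the [X_i ^ q]. Conversely a monomial with an exponent at least [q] is a multiple
    of some [X_i ^ q]. *)
Lemma frobenius_max_ideal (K : fieldType) N p e : p \in [pchar K] ->
  frobenius_power (@max_ideal K N) (p ^ e) = outbox (p ^ e).
Proof.
move=> /(@pchar_mpoly _ N) hp; apply/seteqP; split.
  apply: ideal_gen_min; first exact: outbox_ideal.
  move=> _ [a /ideal_gen_range[b ->] <-]; rewrite expr_sum_pchar //.
  apply: ideal_sum => [|i _]; first exact: outbox_ideal.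
  rewrite exprMn; apply: outboxM; exact: outboxXn.
move=> x Ox; rewrite [x]mpolyE big_seq.
apply: ideal_sum => [|m]; first exact: ideal_gen_ideal.
rewrite mcoeff_msupp => /Ox[i qi].
have -> : m = (m - U_(i) *+ (p ^ e) + U_(i) *+ (p ^ e))%MM.
  rewrite submK //; apply/mnm_lepP => j; rewrite mulmnE mnm1E.
  by case: eqP => [<-|_]; rewrite ?mul1n ?mul0n.
rewrite mpolyXD -mpolyXn -mul_mpolyC mulrA.
case: (ideal_gen_ideal [set a ^+ (p ^ e) | a in @max_ideal K N]) => _ _; apply.
by apply: sub_ideal_gen; exists 'X_i => //; apply: sub_ideal_gen; exists i.
Qed.

(** * Setting variables to zero, and polynomials that avoid them *)

Section Kill.
Variables (K : comNzRingType) (N : nat) (V : pred 'I_N).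

Definition kill : {mpoly K[N]} -> {mpoly K[N]} :=
  mmap (@mpolyC N K) (fun i => if V i then 0 else 'X_i).

HB.instance Definition _ := GRing.RMorphism.copy kill
  (mmap (@mpolyC N K) (fun i => if V i then 0 else 'X_i)).

Lemma killC c : kill c%:MP = c%:MP. Proof. exact: mmapC. Qed.
Lemma killX i : kill 'X_i = if V i then 0 else 'X_i. Proof. exact: mmap_var. Qed.

(** Avoiding the variables in [V] is encoded as a fixed-point equation, so that closure under the
    ring operations follows from [kill] being a morphism. *)
Definition free_of x := kill x = x.

Lemma free_ext (T : nzRingType) (f g : {rmorphism {mpoly K[N]} -> T}) x :
  (forall c, f c%:MP = g c%:MP) -> (forall i, ~~ V i -> f 'X_i = g 'X_i) ->
  free_of x -> f x = g x.
Proof.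
move=> fgC fgX; rewrite /free_of => <-.
apply: (@mpoly_rmorph_ext _ _ _ (f \o kill) (g \o kill)) => [c|i] /=.
  by rewrite killC.
by rewrite killX; case: ifPn => [_|/fgX//]; rewrite !rmorph0.
Qed.

Lemma freeX i : ~~ V i -> free_of 'X_i.
Proof. by rewrite /free_of killX => /negPf->. Qed.
Lemma free0 : free_of 0. Proof. exact: rmorph0. Qed.
Lemma freeD x y : free_of x -> free_of y -> free_of (x + y).
Proof. by rewrite /free_of => Fx Fy; rewrite rmorphD /= Fx Fy. Qed.
Lemma freeN x : free_of x -> free_of (- x).
Proof. by rewrite /free_of => Fx; rewrite rmorphN /= Fx. Qed.
Lemma freeM x y : free_of x -> free_of y -> free_of (x * y).
Proof. by rewrite /free_of => Fx Fy; rewrite rmorphM /= Fx Fy. Qed.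
Lemma freeXn x n : free_of x -> free_of (x ^+ n).
Proof. by rewrite /free_of => Fx; rewrite rmorphXn /= Fx. Qed.

End Kill.

(** * Splitting off one variable, for the lower bound *)

Section Corner.
Variables (K : idomainType) (N : nat) (v : 'I_N).
Local Notation S := {mpoly K[N]}.

(** Polynomials are read as univariate in [X_v]. The coefficients stay in the full ring [S], which
    spares a renumbering of the other variables. *)
Definition split_var : S -> {poly S} :=
  mmap (polyC \o @mpolyC N K) (fun i => if i == v then 'X else ('X_i)%:P).

HB.instance Definition _ := GRing.RMorphism.copy split_var
  (mmap (polyC \o @mpolyC N K) (fun i => if i == v then 'X else ('X_i)%:P)).

Lemma split_var_free x : free_of (pred1 v) x -> split_var x = x%:P.
Proof.
apply: free_ext => [c|i /= iv]; first exact: mmapC.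
by rewrite /split_var mmap_var (negPf iv).
Qed.

Lemma split_varX : split_var 'X_v = 'X.
Proof. by rewrite /split_var mmap_var eqxx. Qed.

(** A large exponent sits either on some [X_i] with [i != v], and then survives in the coefficient,
    or on [X_v], and then the monomial contributes nothing in degree [k < q]. *)
Lemma outbox_split_var q (x : S) k : outbox q x -> (k < q)%N -> outbox q (split_var x)`_k.
Proof.
move=> Ox kq; rewrite [x]mpolyE rmorph_sum coef_sum big_seq.
apply: ideal_sum => [|m]; first exact: outbox_ideal.
rewrite mcoeff_msupp => /Ox[i qi].
rewrite -mul_mpolyC rmorphM /= /split_var mmapC mmapX /mmap1 /= coefCM; apply: outboxM.
rewrite (bigD1 v) //= eqxx.
rewrite (eq_bigr (fun j => ('X_j ^+ m j)%:P)) => [|j /negPf->]; last by rewrite rmorphXn.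
rewrite -rmorph_prod mulrC coefCM coefXn; case: eqP => [km|_]; last first.
  by rewrite mulr0; case: (outbox_ideal K N q).
rewrite mulr1 (bigD1 i) /=; last first.
  by apply: contraTneq qi => ->; rewrite -ltnNge -km.
rewrite mulrC -(subnK qi) exprD mulrA; apply: outboxM; exact: outboxXn.
Qed.

(** Since [h], [r] and [z] are free of [X_v], the coefficient of [X_v ^ q.-1] in the given product
    is [h ^ q.-1 * z]. *)
Lemma outbox_corner q (h r z : S) : (0 < q)%N ->
  free_of (pred1 v) h -> free_of (pred1 v) r -> free_of (pred1 v) z ->
  outbox q (('X_v * h + r) ^+ q.-1 * z) -> outbox q (h ^+ q.-1 * z).
Proof.
move=> q0 Fh Fr Fz /(@outbox_split_var _ _ q.-1); rewrite prednK // leqnn => /(_ isT).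
rewrite rmorphM rmorphXn rmorphD rmorphM /= split_varX !split_var_free // coefMC.
have top n : (('X * h%:P + r%:P) ^+ n)`_n = h ^+ n /\
    forall k, (n < k)%N -> (('X * h%:P + r%:P) ^+ n)`_k = 0.
  elim: n => [|n [IH1 IH2]]; first by split=> [|[|k]]; rewrite expr0 coef1.
  have step k : (('X * h%:P + r%:P) ^+ n.+1)`_k =
      (if k == 0 then 0 else (('X * h%:P + r%:P) ^+ n)`_k.-1) * h +
      (('X * h%:P + r%:P) ^+ n)`_k * r.
    rewrite exprSr; move: (_ ^+ n) => P.
    by rewrite mulrDr coefD coefMC mulrA coefMC coefMX.
  split=> [|[//|k] nk]; rewrite step /=.
    by rewrite IH1 IH2 // mul0r addr0 exprSr.
  by rewrite !IH2 ?mul0r ?addr0 // ltnW.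
by rewrite (top _).1.
Qed.

End Corner.

(** Here [a] acts like a unit. Inside the box the coefficients of [y] vanish by induction on the
    degree: the coefficient of [a * y] at [m] is [a_0 y_m] plus products with coefficients of [y] at
    proper divisors of [m], which lie in the box too. *)
Lemma outbox_cancel (D : idomainType) N q (a y : {mpoly D[N]}) :
  a@_0 != 0 -> outbox q (a * y) -> outbox q y.
Proof.
move=> a0 Oay; suff y0 (m : 'X_{1..N}) : (forall i, m i < q)%N -> y@_m = 0.
  move=> m ym; apply: contrapT => nq; move/negP: ym; apply; apply/eqP/y0 => i.
  by rewrite ltnNge; apply/negP => qi; apply: nq; exists i.
have [n] := ubnP (mdeg m); elim: n m => // n IHn m mn mq.
have /eqP := outboxE Oay mq; rewrite mcoeffM.
have lt0 : (mdeg (0%MM : 'X_{1..N}) < (mdeg m).+1)%N by rewrite mdeg0.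
rewrite (bigD1 (BMultinom lt0, BMultinom (ltnSn (mdeg m)))) /=; last by rewrite add0m.
rewrite big1 ?addr0 => [|[k1 k2] /= /andP[/eqP mE ne]].
  by rewrite mulf_eq0 (negPf a0) => /eqP.
rewrite [y@__]IHn ?mulr0 // => [|i]; last first.
  by apply: leq_ltn_trans (mq i); move/mnmP: mE => ->; rewrite mnmDE leq_addl.
apply: leq_trans (_ : mdeg m <= n)%N; last by rewrite -ltnS.
have := congr1 (@mdeg N) mE; rewrite mdegD => mdE.
rewrite [X in (_ < X)%N]mdE -[X in (X < _)%N]add0n ltn_add2r.
rewrite lt0n mdeg_eq0; apply: contraNneq ne => k10.
rewrite xpair_eqE; apply/andP; split; apply/eqP/val_inj => //=.
by rewrite -[LHS]add0m -k10 -mE.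
Qed.

(** * Upper bound on powers, tested at a prime generated by variables *)

Section Upper.
Variables (K : fieldType) (N : nat) (V : pred 'I_N).
Local Notation S := {mpoly K[N]}.

(** The variables in [V] become outer variables, the others become coefficients. An element outside
    the prime generated by [V] thereby gets a nonzero constant term, as [outbox_cancel] requires. *)
Definition split_vars : S -> {mpoly S[N]} :=
  mmap (@mpolyC N S \o @mpolyC N K) (fun i => if V i then 'X_i else ('X_i)%:MP).

HB.instance Definition _ := GRing.RMorphism.copy split_vars
  (mmap (@mpolyC N S \o @mpolyC N K) (fun i => if V i then 'X_i else ('X_i)%:MP)).

Lemma split_vars0 x : (split_vars x)@_0 = kill V x.
Proof.
apply: (@mpoly_rmorph_ext _ _ _ (mcoeff 0 \o split_vars) (kill V)) => [c|i] /=.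
  by rewrite /split_vars mmapC /= mpolyCK killC.
rewrite /split_vars mmap_var killX; case: ifP => _; last by rewrite mpolyCK.
by rewrite mcoeffX mnm1_eq0.
Qed.

Lemma split_varsK x : mmap idfun (fun i => 'X_i) (split_vars x) = x.
Proof.
apply: (@mpoly_rmorph_ext _ _ _
  (mmap idfun (fun i => 'X_i : S) \o split_vars) idfun) => [c|i] /=.
  by rewrite /split_vars mmapC /= mmapC.
by rewrite /split_vars mmap_var; case: ifP; rewrite ?mmap_var ?mmapC.
Qed.

Lemma outbox_split_vars q (x : S) : outbox q (split_vars x) -> outbox q x.
Proof.
move=> Ox; rewrite -[x]split_varsK [split_vars x]mpolyE rmorph_sum big_seq.
apply: ideal_sum => [|m]; first exact: outbox_ideal.
rewrite mcoeff_msupp => /Ox[i qi].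
rewrite -mul_mpolyC rmorphM /= mmapC mmapX /mmap1; apply: outboxM.
rewrite (bigD1 i) //= mulrC -(subnK qi) exprD mulrA; apply: outboxM; exact: outboxXn.
Qed.

(** The constant term [kill V t] vanishes, so every monomial of [split_vars t] has a positive
    exponent, which Frobenius multiplies by [p ^ e]. *)
Lemma split_vars_pow p e t : p \in [pchar K] -> kill V t = 0 ->
  outbox (p ^ e) (split_vars t ^+ (p ^ e)).
Proof.
move=> hp t0; rewrite [split_vars t]mpolyE expr_sum_pchar; last exact/pchar_mpoly/pchar_mpoly.
rewrite big_seq; apply: ideal_sum => [|m]; first exact: outbox_ideal.
rewrite mcoeff_msupp => tm; rewrite -mul_mpolyC exprMn.
apply: outboxM.
have [i mi] : exists i, m i != 0%N.
  apply/existsP; rewrite -negb_forall; apply: contra tm => /forallP m0.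
  suff -> : m = 0%MM by rewrite split_vars0 t0.
  by apply/mnmP => i; rewrite mnm0E (eqP (m0 i)).
rewrite mpolyXE_id -prodrXl (bigD1 i) //= mulrC.
apply: outboxM.
rewrite -exprM mulnC exprM -(prednK (n := m i)) ?lt0n // exprS mulrC.
apply: outboxM; exact: outboxXn.
Qed.

(** [s ^ M] times a product of [M] elements of [J] is a combination of monomials of degree [M] in
    the [t i]. By pigeonhole one exponent is at least [p ^ e], and [s ^ M] is then cancelled in the
    ring of [split_vars]. *)
Lemma ideal_exp_outbox p e (J : set S) (s : S) (t : 'I_3 -> S) M :
  p \in [pchar K] -> kill V s != 0 -> (forall i, kill V (t i) = 0) ->
  (forall x, J x -> ideal_gen (range t) (s * x)) ->
  (3 * (p ^ e).-1 < M)%N -> ideal_exp J M `<=` outbox (p ^ e).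
Proof.
move=> hp s0 t0 sJ MM; apply: ideal_gen_min; first exact: outbox_ideal.
move=> _ [f [Jf ->]].
have : outbox (p ^ e) (split_vars (s ^+ M * \prod_i f i)).
  have -> : s ^+ M * \prod_i f i = \prod_i (s * f i).
    by rewrite big_split /= prodr_const card_ord.
  (* The [n]-th power of the ideal of the [t i], presented by monomials in these generators so that
     exponents can be counted. *)
  pose T n : set S := ideal_gen [set x | exists c : 'I_3 -> nat,
    (\sum_i c i)%N = n /\ x = \prod_i t i ^+ c i].
  have TI n : is_ideal (T n) by exact: ideal_gen_ideal.
  have TS n x y : ideal_gen (range t) x -> T n y -> T n.+1 (x * y).
    move=> tx Ty.
    have II1 : is_ideal [set x | T n.+1 (x * y)].
      case: (TI n.+1) => T0 TD TM; split=> /= [|a b Ta Tb|a b Tb].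
      - by rewrite mul0r.
      - by rewrite mulrDl; apply: TD.
      - by rewrite -mulrA; apply: TM.
    apply: (ideal_gen_min II1) tx => _ [i _ <-] /=.
    have II2 : is_ideal [set y | T n.+1 (t i * y)].
      case: (TI n.+1) => T0 TD TM; split=> /= [|a b Ta Tb|a b Tb].
      - by rewrite mulr0.
      - by rewrite mulrDr; apply: TD.
      - by rewrite mulrCA; apply: TM.
    apply: (ideal_gen_min II2) Ty => _ [c [cn ->]] /=.
    apply: sub_ideal_gen; exists (fun j => (j == i) + c j)%N; split.
      by rewrite big_split /= cn (bigD1 i) //= eqxx big1 // => j /negPf->.
    rewrite [RHS](eq_bigr (fun j => t j ^+ (j == i) * t j ^+ c j)); last first.
      by move=> j _; rewrite exprD.
    rewrite [RHS]big_split /=; congr (_ * _); rewrite (bigD1 i) //= eqxx big1 ?mulr1 // => j.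
    by move=> /negPf->.
  have : T M (\prod_i (s * f i)).
    elim: (M) (f) Jf => [|n IHn] g Jg.
      rewrite big_ord0; apply: sub_ideal_gen; exists (fun=> 0%N).
      by rewrite big1 // big1.
    by rewrite big_ord_recl; apply: TS; [apply: sJ | apply: IHn].
  apply: (@ideal_gen_min _ _ [set x | outbox (p ^ e) (split_vars x)]).
    exact/ideal_preim/outbox_ideal.
  move=> _ [c [cM ->]] /=; have [i ci] : exists i, (p ^ e <= c i)%N.
    apply/existsP; apply: contraLR MM => /existsPn cq; rewrite -leqNgt -cM.
    apply: leq_trans (_ : \sum_(i < 3) (p ^ e).-1 <= _)%N; last first.
      by rewrite sum_nat_const card_ord.
    apply: leq_sum => i _; have := cq i; rewrite -ltnNge.
    by case: (p ^ e)%N.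
  rewrite (bigD1 i) //= -(subnK ci) exprD mulrAC rmorphM rmorphXn.
  apply: outboxM.
  exact: split_vars_pow.
rewrite rmorphM rmorphXn /= => H; apply/(@outbox_split_vars (p ^ e))/(outbox_cancel _ H).
by rewrite rmorphXn /= split_vars0 expf_neq0.
Qed.

End Upper.

(** * From bounds at each [p ^ e] to the F-pure threshold *)

Lemma cvg_threshold (R : realType) p : (1 < p)%N ->
  ((fun e => (3 * (p ^ e).-1)%:R / (p ^ e)%:R : R) @ \oo --> (3%:R : R))%classic.
Proof.
move=> p1; have -> : (fun e => (3 * (p ^ e).-1)%:R / (p ^ e)%:R : R) =
    (fun e => 3%:R - 3%:R * (p%:R^-1) ^+ e).
  apply/funext => e; have pe : (0 < p ^ e)%N by rewrite expn_gt0 ltnW.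
  rewrite -subn1 natrM natrB // mulrBr mulr1 mulrBl mulfK ?pnatr_eq0 -?lt0n //.
  by rewrite natrX exprVn.
rewrite -[X in _ --> X]subr0; apply: cvgB; first exact: cvg_cst.
rewrite -[X in _ --> X](mulr0 3%:R); apply: cvgM; first exact: cvg_cst.
apply: cvg_expr; rewrite ger0_norm ?invr_ge0 ?ler0n //.
by rewrite invf_lt1 ?ltr1n ?ltr0n // ltnW.
Qed.

(** This forces [nu (p ^ e)] to be at least [3 * (p ^ e).-1]; the three elements may vary with
    [e]. *)
Definition fpt_ge3 (K : fieldType) p N (J : set {mpoly K[N]}) : Prop :=
  forall e, exists h : 'I_3 -> {mpoly K[N]},
    (forall i, J (h i)) /\ ~ outbox (p ^ e) ((\prod_i h i) ^+ (p ^ e).-1).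

(* At the prime generated by the variables in V, the ideal J is contained in an
   ideal generated by three elements of that prime. *)
Definition locally_3gen (K : fieldType) N (J : set {mpoly K[N]}) : Prop :=
  exists (V : pred 'I_N) (s : {mpoly K[N]}) (t : 'I_3 -> {mpoly K[N]}),
    [/\ kill V s != 0, forall i, kill V (t i) = 0 &
        forall x, J x -> ideal_gen (range t) (s * x)].

Lemma has_fpt3 (R : realType) (K : fieldType) p N (J : set {mpoly K[N]}) :
  p \in [pchar K] -> fpt_ge3 p J -> locally_3gen J -> has_fpt p J (3%:R : R).
Proof.
move=> hp lo [V [s [t [s0 t0 sJ]]]]; exists (fun e => 3 * (p ^ e).-1)%N.
split; last by apply: cvg_threshold; case/andP: hp => /prime_gt1.
move=> e; rewrite /is_nu frobenius_max_ideal //; split; last first.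
  move=> r; apply: contra_notT; rewrite -ltnNge => r3.
  exact: (ideal_exp_outbox hp s0 t0 sJ).
have [h [Jh nO]] := lo e => sub; apply/nO/sub.
set n := _.-1; pose s' := nseq n (h 0) ++ nseq n (h 1) ++ nseq n (h 2%:R).
have -> : (3 * n)%N = size s' by rewrite !size_cat !size_nseq !mulSn mul0n addn0.
have -> : (\prod_i h i) ^+ n = \prod_(x <- s') x.
  rewrite !big_cat /= !big_nseq !iter_mulr !mulr1 mulrA -!exprMn.
  rewrite !big_ord_recl big_ord0 mulr1 mulrA; congr ((_ * h _ * h _) ^+ _); exact: val_inj.
by apply: prod_ideal_exp => x; rewrite !mem_cat !mem_nseq => /or3P[] /andP[_ /eqP->].
Qed.

(** * Elimination of variables and height *)

Lemma mpoly_closure n (R : comNzRingType) (Q : {mpoly R[n]} -> Prop) :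
  (forall c, Q c%:MP) -> (forall i, Q 'X_i) ->
  (forall x y, Q x -> Q y -> Q (x + y)) -> (forall x y, Q x -> Q y -> Q (x * y)) ->
  forall x, Q x.
Proof.
move=> QC QX QD QM x; rewrite [x]mpolyE.
apply: (big_ind Q) => [|x1 x2|m _]; [exact: (QC 0) | exact: QD |].
rewrite -mul_mpolyC mpolyXE_id; apply: (QM) => //.
apply: (big_ind Q) => [|x1 x2|i _]; [exact: (QC 1) | exact: QM |].
by elim: (m i) => [|k IHk]; [exact: (QC 1) | rewrite exprS; apply: QM].
Qed.

Definition ker_set (A B : nzRingType) (f : A -> B) : set A := [set x | f x = 0].

(* A chain of three primes strictly below P, given as kernels so that it can be
   carried along polynomial extensions. *)
Definition hom_chain3 (A : comNzRingType) (P : set A) : Prop :=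
  exists (D : idomainType) (f : nat -> {rmorphism A -> D}),
    (forall i, (i < 2)%N -> ker_set (f i) `<` ker_set (f i.+1)) /\
    ker_set (f 2) `<` P.

Lemma hom_chain3_prime (A : comNzRingType) (P : set A) :
  prime_ideal P -> hom_chain3 P -> prime_chain 3 P.
Proof.
move=> PP [D [f [lt1 lt2]]]; exists (fun i => if (i < 3)%N then ker_set (f i) else P).
split=> [i _|[|[|[|i]]] //= _|//]; try exact: lt1.
by case: ifP => // _; exact: ker_prime.
Qed.

Section Elimination.
Variables (K : fieldType) (N d : nat) (v : 'I_d -> 'I_N).
Local Notation S := {mpoly K[N]}.
Variables (s : S) (r : 'I_d -> S).
Let W : pred 'I_N := [pred j | [exists i, v i == j]].
Hypotheses (v_inj : injective v) (s0 : s != 0).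
Hypotheses (Fs : free_of W s) (Fr : forall i, free_of W (r i)).

Local Notation tofrac := (@tofrac S).
Let e i := s * 'X_(v i) + r i.

(** Solves the first [k] equations [s v_i + r_i = 0] for the [v_i] over the fraction field. The
    kernels of these substitutions, for growing [k], supply the primes of the chain. *)
Definition elim_var k (j : 'I_N) : {fraction S} :=
  if [pick i | (v i == j) && (i < k)%N] is Some i then - tofrac (r i) / tofrac s
  else tofrac 'X_j.

Definition elim_hom k : S -> {fraction S} := mmap (tofrac \o @mpolyC N K) (elim_var k).

HB.instance Definition _ k := GRing.RMorphism.copy (elim_hom k)
  (mmap (tofrac \o @mpolyC N K) (elim_var k)).

Lemma elim_homX k j : elim_hom k 'X_j = elim_var k j.
Proof. exact: mmap_var. Qed.

Lemma elim_hom_free k x : free_of W x -> elim_hom k x = tofrac x.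
Proof.
apply: free_ext => [c|j Wj]; first exact: mmapC.
rewrite /= elim_homX /elim_var; case: pickP => // i /andP[ij _].
by case/existsP: Wj; exists i.
Qed.

Lemma elim_hom_var k i : elim_hom k 'X_(v i) =
  if (i < k)%N then - tofrac (r i) / tofrac s else tofrac 'X_(v i).
Proof.
rewrite elim_homX /elim_var; case: pickP => [j /andP[/eqP/v_inj -> ->] //|].
by move/(_ i); rewrite eqxx /= => ->.
Qed.

Lemma elim_hom_eq k i : elim_hom k (e i) = if (i < k)%N then 0 else tofrac (e i).
Proof.
rewrite rmorphD rmorphM /= elim_hom_var !elim_hom_free //; case: ifP => _.
  by rewrite mulrC divfK ?tofrac_eq0 // addNr.
by rewrite -tofracM -tofracD.
Qed.

Lemma elim_eq_neq0 i : e i != 0.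
Proof.
apply/eqP => ei0; have r0 : r i = 0.
  rewrite -Fr -[RHS](rmorph0 (kill W)) -ei0 rmorphD rmorphM /= killX ifT ?mulr0 ?add0r //.
  by apply/existsP; exists i.
by move/eqP: ei0; rewrite /e r0 addr0 mulf_eq0 (negPf s0) -msize_poly_eq0 msizeX.
Qed.

(** Clearing denominators: modulo the first [k] equations, some [s ^ M * x] equals a polynomial [y]
    that represents [s ^ M] times the image of [x]. If that image is zero, so is [y]. *)
Lemma elim_ker k x : elim_hom k x = 0 ->
  exists M, ideal_gen [set y | exists i : 'I_d, (i < k)%N /\ y = e i] (s ^+ M * x).
Proof.
set E := ideal_gen _; have EI : is_ideal E by exact: ideal_gen_ideal.
suff [M [y [Exy yE]]] : exists M y, E (s ^+ M * x - y) /\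
    tofrac y = tofrac s ^+ M * elim_hom k x.
  move=> x0; exists M; move: yE; rewrite x0 mulr0 => /eqP; rewrite tofrac_eq0 => /eqP y0.
  by rewrite y0 subr0 in Exy.
have E0 : E 0 by case: EI.
elim/mpoly_closure: x => [c|j|x1 x2|x1 x2].
- by exists 0%N, c%:MP; rewrite !expr0 !mul1r subrr [elim_hom _ _]mmapC.
- case: (boolP [exists i, (v i == j) && (i < k)%N]) => [/existsP[i /andP[/eqP <- ik]]|nex].
    exists 1%N, (- r i); rewrite !expr1 opprK elim_hom_var ik; split.
      by apply: sub_ideal_gen; exists i.
    by rewrite mulrC divfK ?tofrac_eq0 // tofracN.
  exists 0%N, 'X_j; rewrite !expr0 !mul1r subrr elim_homX /elim_var; split=> //.
  by case: pickP => // i ij; case/existsP: nex; exists i.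
- move=> [M1 [y1 [E1 t1]]] [M2 [y2 [E2 t2]]].
  exists (M1 + M2)%N, (s ^+ M2 * y1 + s ^+ M1 * y2); split; last first.
    by rewrite tofracD !tofracM !tofracXn t1 t2 rmorphD exprD; ring.
  have -> : s ^+ (M1 + M2) * (x1 + x2) - (s ^+ M2 * y1 + s ^+ M1 * y2) =
     s ^+ M2 * (s ^+ M1 * x1 - y1) + s ^+ M1 * (s ^+ M2 * x2 - y2) by rewrite exprD; ring.
  by case: EI => _ ED EM; apply: ED; apply: EM.
- move=> [M1 [y1 [E1 t1]]] [M2 [y2 [E2 t2]]].
  exists (M1 + M2)%N, (y1 * y2); split; last first.
    by rewrite tofracM t1 t2 rmorphM exprD; ring.
  have -> : s ^+ (M1 + M2) * (x1 * x2) - y1 * y2 =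
     y2 * (s ^+ M1 * x1 - y1) + s ^+ M1 * x1 * (s ^+ M2 * x2 - y2) by rewrite exprD; ring.
  by case: EI => _ ED EM; apply: ED; apply: EM.
Qed.

Lemma elim_ker_sub k (P : set S) : prime_ideal P ->
  (forall i : 'I_d, (i < k)%N -> P (e i)) -> ~ P s -> ker_set (elim_hom k) `<=` P.
Proof.
move=> PP Pe Ps x /elim_ker[M Ex]; case/prime_idealP: (PP) => PI _ PM.
have [|/(prime_exp PP)//|//] := PM (s ^+ M) x.
by apply: (ideal_gen_min PI) Ex => _ [i [ik ->]]; apply: Pe.
Qed.

Lemma elim_hom_s k : elim_hom k s != 0.
Proof. by rewrite elim_hom_free // tofrac_eq0. Qed.

(** The inclusion is strict because [e k] lies in [P], while [elim_hom k] has not yet eliminated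
    [v k] and keeps [e k] nonzero. *)
Lemma elim_ker_proper (P : set S) (k : 'I_d) : prime_ideal P ->
  (forall i : 'I_d, (i <= k)%N -> P (e i)) -> ~ P s -> ker_set (elim_hom k) `<` P.
Proof.
move=> PP Pe Ps; split=> [|/(_ (e k) (Pe _ (leqnn _)))]; last first.
  by rewrite /ker_set /= elim_hom_eq ltnn => /eqP; rewrite tofrac_eq0 (negPf (elim_eq_neq0 _)).
by apply: elim_ker_sub => // i /ltnW; apply: Pe.
Qed.

Lemma elim_ker_alg_indep k x : free_of W x -> elim_hom k x = 0 -> x = 0.
Proof. by move=> /elim_hom_free -> /eqP; rewrite tofrac_eq0 => /eqP. Qed.

End Elimination.

Lemma elim_hom_chain3 (K : fieldType) N (v : 'I_3 -> 'I_N) (s : {mpoly K[N]})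
    (r : 'I_3 -> {mpoly K[N]}) (P : set {mpoly K[N]}) :
  injective v -> free_of [pred j | [exists i, v i == j]] s ->
  (forall i, free_of [pred j | [exists i, v i == j]] (r i)) ->
  prime_ideal P -> ~ P s -> (forall i, P (s * 'X_(v i) + r i)) -> hom_chain3 P.
Proof.
move=> v_inj Fs Fr PP Ps Pe; have s0 : s != 0.
  by apply: contra_notN Ps => /eqP ->; case/prime_idealP: PP => -[].
exists {fraction {mpoly K[N]}}, (fun k => elim_hom v s r k); split=> [i i2|]; last first.
  exact: (elim_ker_proper v_inj s0 Fs Fr (k := ord_max)).
have i3 : (i < 3)%N by exact: ltnW.
(* The next kernel takes the place of [P]: it is prime, contains the equations up to index [i] and
   avoids [s]. *)
apply: (elim_ker_proper v_inj s0 Fs Fr (k := Ordinal i3)); first exact: ker_prime.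
- by move=> j ji; rewrite /ker_set /= elim_hom_eq // ltnS ji.
- by apply/eqP/elim_hom_s.
Qed.

(** * Algebraic independence modulo a prime and the length of prime chains *)

Section AlgIndep.
Variables (K : fieldType) (N : nat).
Local Notation S := {mpoly K[N]}.

Definition eval_at d (x : 'I_d -> S) : {mpoly K[d]} -> S := mmap (@mpolyC N K) x.

HB.instance Definition _ d (x : 'I_d -> S) := GRing.RMorphism.copy (eval_at x)
  (mmap (@mpolyC N K) x).

Lemma eval_atC d (x : 'I_d -> S) c : eval_at x c%:MP = c%:MP.
Proof. exact: mmapC. Qed.
Lemma eval_atX d (x : 'I_d -> S) i : eval_at x 'X_i = x i.
Proof. exact: mmap_var. Qed.

Definition alg_indep (P : set S) d (x : 'I_d -> S) : Prop :=
  forall F, P (eval_at x F) -> F = 0.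

Definition last_poly d : {mpoly K[d.+1]} -> {poly {mpoly K[d]}} :=
  mmap (polyC \o @mpolyC d K)
    (fun i => oapp (fun j => ('X_j)%:P) 'X (unlift ord_max i)).

HB.instance Definition _ d := GRing.RMorphism.copy (@last_poly d)
  (mmap (polyC \o @mpolyC d K)
    (fun i => oapp (fun j => ('X_j)%:P) 'X (unlift ord_max i))).

Definition widen_mpoly d : {mpoly K[d]} -> {mpoly K[d.+1]} :=
  mmap (@mpolyC d.+1 K) (fun j => 'X_(lift ord_max j)).

HB.instance Definition _ d := GRing.RMorphism.copy (@widen_mpoly d)
  (mmap (@mpolyC d.+1 K) (fun j => 'X_(lift ord_max j))).

Lemma last_polyC d c : @last_poly d c%:MP = c%:MP%:P. Proof. exact: mmapC. Qed.
Lemma last_polyX d i :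
  @last_poly d 'X_i = oapp (fun j => ('X_j)%:P) 'X (unlift ord_max i).
Proof. exact: mmap_var. Qed.
Lemma widen_mpolyC d c : @widen_mpoly d c%:MP = c%:MP. Proof. exact: mmapC. Qed.
Lemma widen_mpolyX d j : @widen_mpoly d 'X_j = 'X_(lift ord_max j).
Proof. exact: mmap_var. Qed.

Lemma last_polyK d F :
  horner_eval 'X_ord_max (map_poly (@widen_mpoly d) (last_poly F)) = F.
Proof.
apply: (@mpoly_rmorph_ext _ _ _
  (horner_eval ('X_ord_max) \o map_poly (@widen_mpoly d) \o @last_poly d) idfun) => [c|i] /=.
  by rewrite last_polyC map_polyC /horner_eval hornerC /= widen_mpolyC.
rewrite last_polyX; case: unliftP => [j ->|->] /=.
  by rewrite map_polyC /horner_eval hornerC /= widen_mpolyX.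
by rewrite map_polyX /horner_eval hornerX.
Qed.

(** Any [y] in [Q] but not in [P] can be appended. In a relation modulo [P], the constant
    coefficient in [y] lies in [Q] after evaluation, hence is zero; the remaining terms are
    divisible by [y], which cancels because [P] is prime. Induction on the polynomial in [y]
    finishes. *)
Lemma alg_indep_extend (P Q : set S) d (x : 'I_d -> S) :
  prime_ideal P -> is_ideal Q -> P `<` Q -> alg_indep Q x ->
  exists x' : 'I_d.+1 -> S, alg_indep P x'.
Proof.
move=> PP QI [PQ nQP] xQ.
have [y Qy Py] : exists2 y, Q y & ~ P y.
  by apply: contra_notP nQP => nex y Qy; apply: contrapT => Py; apply: nex; exists y.
exists (fun i => oapp x y (unlift ord_max i)) => F.
set ev := eval_at _.
have -> : ev F = horner_eval y (map_poly (eval_at x) (last_poly F)).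
  apply: (@mpoly_rmorph_ext _ _ _ ev
    (horner_eval y \o map_poly (eval_at x) \o @last_poly d)) => [c|i] /=.
    by rewrite [LHS]eval_atC last_polyC map_polyC /horner_eval hornerC /= eval_atC.
  rewrite [LHS]eval_atX last_polyX; case: unliftP => [j _|_] /=.
    by rewrite map_polyC /horner_eval hornerC /= eval_atX.
  by rewrite map_polyX /horner_eval hornerX.
suff key (G : {poly {mpoly K[d]}}) : P (horner_eval y (map_poly (eval_at x) G)) -> G = 0.
  by move/key => F0; rewrite -(last_polyK F) F0 rmorph0 rmorph0.
case/prime_idealP: (PP) => PI _ PM; case: (QI) => _ QD QZ.
elim/poly_ind: G => [//|G c IHG] /=.
rewrite /horner_eval rmorphD rmorphM /= map_polyX map_polyC hornerMXaddC => Pe.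
have c0 : c = 0.
  apply: xQ; rewrite -[eval_at x c](addKr ((map_poly (eval_at x) G).[y] * y)) addrC.
  by apply: idealB => //; [exact: PQ | exact: QZ].
have ev0 : eval_at x c = 0 by rewrite c0; exact: (rmorph0 (eval_at x)).
move: Pe; rewrite /= ev0 addr0 c0 => Pe; have [/IHG ->|//] := PM _ _ Pe.
by rewrite mul0r add0r polyC0.
Qed.

Lemma alg_indep_chain (P : set S) h d (x : 'I_d -> S) :
  prime_chain h P -> alg_indep P x -> exists x' : 'I_(d + h) -> S, alg_indep [set 0] x'.
Proof.
case=> c [cP clt <-] xP.
have key i : (i <= h)%N -> exists x' : 'I_(d + i) -> S, alg_indep (c (h - i)%N) x'.
  elim: i => [_|i IHi ih]; first by rewrite subn0 addn0; exists x.
  have [x' x'P] := IHi (ltnW ih).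
  have hi : (h - i.+1 < h)%N by rewrite ltn_subrL (leq_trans _ ih).
  have hiS : (h - i.+1).+1 = (h - i)%N by rewrite -subSn // subSS.
  rewrite addnS; apply: (@alg_indep_extend _ (c (h - i)%N) _ x') => //.
  - by apply: cP; rewrite ltnW.
  - by case/prime_idealP: (cP _ (leq_subr i h)).
  - by rewrite -hiS; apply: clt.
have [x' x'P] := key h (leqnn h); exists x' => F /= F0; apply: x'P; rewrite F0 subnn.
by case/prime_idealP: (cP 0%N isT) => -[].
Qed.

Definition degree_le (v : 'I_N) k (x : S) : Prop := forall m, x@_m != 0 -> (m v <= k)%N.

Lemma degree_leM v k l x y :
  degree_le v k x -> degree_le v l y -> degree_le v (k + l) (x * y).
Proof.
move=> dx dy m; rewrite -mcoeff_msupp => /msuppM_le /allpairsP[[m1 m2] /= [m1x m2y ->]].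
by rewrite mnmDE leq_add ?dx ?dy -?mcoeff_msupp.
Qed.

Lemma degree_leD v k x y : degree_le v k x -> degree_le v k y -> degree_le v k (x + y).
Proof.
move=> dx dy m; rewrite mcoeffD; case: (eqVneq x@_m 0) => [->|/dx//].
by rewrite add0r => /dy.
Qed.

Lemma degree_leC v c : degree_le v 0 c%:MP.
Proof.
by move=> m; rewrite mcoeffC; case: (eqVneq m 0%MM) => [->|]; rewrite ?mnm0E ?mulr0 ?eqxx.
Qed.

Lemma degree_le1 v : degree_le v 0 1.
Proof. by rewrite -mpolyC1; exact: degree_leC. Qed.

Lemma degree_le_sum v k (T : Type) (r : seq T) (F : T -> S) :
  (forall i, degree_le v k (F i)) -> degree_le v k (\sum_(i <- r) F i).
Proof.
move=> dF; apply: (big_ind (degree_le v k)) => // [m|x y]; last exact: degree_leD.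
by rewrite mcoeff0 eqxx.
Qed.

Lemma degree_leXn v k x n : degree_le v k x -> degree_le v (k * n) (x ^+ n).
Proof.
move=> dx; elim: n => [|n IHn]; first by rewrite muln0 expr0; exact: degree_le1.
by rewrite exprS mulnS; apply: degree_leM.
Qed.

Lemma degree_le_weak v k l x : (k <= l)%N -> degree_le v k x -> degree_le v l x.
Proof. by move=> kl dx m /dx /leq_trans; apply. Qed.

Lemma degree_le_prod v (T : Type) (r : seq T) (k : T -> nat) (F : T -> S) :
  (forall i, degree_le v (k i) (F i)) ->
  degree_le v (\sum_(i <- r) k i) (\prod_(i <- r) F i).
Proof.
move=> dF; elim: r => [|a r IHr]; first by rewrite !big_nil; exact: degree_le1.
by rewrite !big_cons; apply: degree_leM.
Qed.

Lemma degree_bound d (x : 'I_d -> S) : exists b, forall i v, degree_le v b (x i).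
Proof.
exists (\sum_i msize (x i))%N => i v m; rewrite -mcoeff_msupp => /msize_mdeg_lt mx.
apply: leq_trans (_ : mdeg m <= _)%N; first by rewrite mdegE (bigD1 v) //= leq_addr.
by apply: leq_trans (ltnW mx) _; rewrite (bigD1 i) //= leq_addr.
Qed.

(* Pigeonhole: the D^d monomials with exponents below D in d elements live in
   a space of dimension at most a constant times D^N. *)
Lemma alg_indep_leq d (x : 'I_d -> S) : alg_indep [set 0] x -> (d <= N)%N.
Proof.
move=> x0; rewrite leqNgt; apply/negP => Nd; have [b xb] := degree_bound x.
(* [E] exceeds the degree in each variable of the monomials considered. As [E <= D * (d * b).+1] and
   [D > (d * b).+1 ^ N], one gets [E ^ N < D ^ N.+1 <= D ^ d]. *)
pose D := ((d * b).+1 ^ N).+1; pose E := (d * (D * b)).+1.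
pose T1 := {ffun 'I_d -> 'I_D}; pose T2 := {ffun 'I_N -> 'I_E}.
have lt21 : (#|T2| < #|T1|)%N.
  rewrite !card_ffun !card_ord; apply: leq_trans (_ : D ^ N.+1 <= _)%N; last first.
    by rewrite leq_pexp2l.
  apply: leq_ltn_trans (_ : (D * (d * b).+1) ^ N < _)%N.
    have wexp a c n : (a <= c -> a ^ n <= c ^ n)%N by case: n => // n ac; rewrite leq_exp2r.
    by apply: wexp; rewrite /E mulnS mulnCA -addn1 addnC leq_add2r.
  by rewrite expnMn expnSr ltn_pmul2l // expn_gt0.
pose mon1 (a : T1) : 'X_{1..d} := [multinom (a i : nat) | i < d].
pose mon2 (a : T2) : 'X_{1..N} := [multinom (a i : nat) | i < N].
pose A : 'M[K]_(#|T1|, #|T2|) :=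
  \matrix_(i, j) (eval_at x 'X_[mon1 (enum_val i)])@_(mon2 (enum_val j)).
(* There are more rows than columns; a vector in the left kernel of the coefficient matrix is an
   algebraic relation between the [x i]. *)
have kerA : kermx A != 0.
  by rewrite kermx_eq0 /row_free neq_ltn (leq_ltn_trans (rank_leq_col A) lt21).
pose u := nz_row (kermx A).
have u0 : u != 0 by rewrite nz_row_eq0.
have uA : u *m A = 0 by apply/sub_kermxP/nz_row_sub.
pose F := \sum_i u 0 i *: 'X_[K, mon1 (enum_val i)].
have inj1 : injective mon1.
  move=> f g fg; apply/ffunP => i; apply: val_inj.
  by move/mnmP/(_ i): fg; rewrite !mnmE.
have F0 : F = 0.
  apply: x0 => /=; apply/mpolyP => m; rewrite mcoeff0 rmorph_sum raddf_sum /=.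
  pose g (i : 'I_#|T1|) := (eval_at x 'X_[mon1 (enum_val i)])@_m.
  rewrite (eq_bigr (fun i => u 0 i * g i)) => [|i _]; last first.
    by rewrite -mul_mpolyC rmorphM /= eval_atC mcoeffCM.
  have [mE|] := boolP [forall v, m v < E]%N; last first.
    rewrite negb_forall => /existsP[v]; rewrite -leqNgt => mv; rewrite big1 // => i _.
    suff -> : g i = 0 by rewrite mulr0.
    apply/eqP/negPn/negP => H.
    have dX : degree_le v (d * (D * b)) (eval_at x 'X_[mon1 (enum_val i)]).
      rewrite mpolyXE_id rmorph_prod.
      apply: (@degree_le_weak _ (\sum_j b * mon1 (enum_val i) j)%N); last first.
        by apply: degree_le_prod => j; rewrite rmorphXn /= eval_atX; apply: degree_leXn; exact: xb.
      rewrite -[X in (_ <= X * _)%N](card_ord d) -sum_nat_const; apply: leq_sum => j _.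
      by rewrite mnmE mulnC leq_mul2r ltnW ?orbT.
    by have := dX m H; rewrite leqNgt mv.
  have [j jm] : exists j : 'I_#|T2|, m = mon2 (enum_val j).
    exists (enum_rank [ffun v => Ordinal (forallP mE v)]).
    by apply/mnmP => v; rewrite enum_rankK mnmE ffunE.
  move/matrixP/(_ 0 j): uA; rewrite !mxE => uAj.
  rewrite (eq_bigr (fun i => u 0 i * A i j)) => [|i _]; first exact: uAj.
  by rewrite mxE /g jm.
case/negP: u0; apply/eqP/rowP => i; rewrite mxE.
move/mpolyP/(_ (mon1 (enum_val i))): F0; rewrite mcoeff0 raddf_sum /= (bigD1 i) //=.
rewrite mcoeffZ mcoeffX eqxx mulr1 big1 ?addr0 // => j ji.
rewrite mcoeffZ mcoeffX; case: eqP => [/inj1/enum_val_inj ij|_]; last by rewrite mulr0.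
by rewrite ij eqxx in ji.
Qed.

End AlgIndep.

(** * Criteria for height three *)

Definition height_ge3 (K : fieldType) N (J : set {mpoly K[N]}) : Prop :=
  forall P, prime_ideal P -> J `<=` P -> hom_chain3 P.

(** Each step down a chain from [Q] adds an independent element, and at most [N] elements are
    independent, so chains ending at [Q] have length at most three. *)
Definition height_le3 (K : fieldType) N (J : set {mpoly K[N]}) : Prop :=
  exists Q d (x : 'I_d -> {mpoly K[N]}),
    [/\ prime_ideal Q, J `<=` Q, alg_indep Q x & (N <= d + 3)%N].

Lemma has_height_eq3 (K : fieldType) N (J : set {mpoly K[N]}) g :
  height_ge3 J -> height_le3 J -> has_height J g -> g = 3%N.
Proof.
move=> ge3 [Q [d [x [QP JQ xQ Nd]]]] [[P [PP JP [_ Pg]]] min_g].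
have ge : (3 <= g)%N by apply/Pg/hom_chain3_prime/ge3.
have chain_le h : prime_chain h Q -> (h <= 3)%N.
  move=> /alg_indep_chain/(_ xQ)[x' /alg_indep_leq dh].
  by rewrite -(leq_add2l d) (leq_trans dh).
(* [has_height] compares [g] only with primes that have a height. [Q] gets one as the largest length
   of a chain ending at it; these lengths are bounded by three. *)
have exC : exists h, `[< prime_chain h Q >] by exists 3%N; apply/asboolP/hom_chain3_prime/ge3.
have ubC h : `[< prime_chain h Q >] -> (h <= 3)%N by move/asboolP/chain_le.
case: (ex_maxnP exC ubC) => h /asboolP Qh hmax.
apply/eqP; rewrite eqn_leq ge andbT (leq_trans _ (chain_le _ Qh)) //.
apply: (min_g Q) => //; split=> // h' Qh'; apply: hmax; exact/asboolP.
Qed.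

(** The prime is the kernel of the full elimination; modulo it the variables other than the three
    [v i] stay independent. *)
Lemma elim_height_le3 (K : fieldType) N (v : 'I_3 -> 'I_N) (s : {mpoly K[N]})
    (r : 'I_3 -> {mpoly K[N]}) (J : set {mpoly K[N]}) :
  injective v -> s != 0 -> free_of [pred j | [exists i, v i == j]] s ->
  (forall i, free_of [pred j | [exists i, v i == j]] (r i)) ->
  J `<=` ker_set (elim_hom v s r 3) -> height_le3 J.
Proof.
move=> v_inj s0 Fs Fr JQ; pose W : pred 'I_N := [pred j | [exists i, v i == j]].
pose U := [set j | ~~ W j]%SET; pose x (i : 'I_#|U|) : {mpoly K[N]} := 'X_(enum_val i).
exists (ker_set (elim_hom v s r 3)), #|U|, x; split=> // [|F|]; first exact: ker_prime.
- have Fx : free_of W (eval_at x F).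
    apply: (@mpoly_rmorph_ext _ _ _ (kill W \o eval_at x) (eval_at x)) => [c|i] /=.
      by rewrite eval_atC killC.
    by rewrite eval_atX killX; have := enum_valP i; rewrite inE => /negPf ->.
  move/(elim_ker_alg_indep Fx) => F0.
  (* Renaming the variables back recovers [F] from its value. *)
  pose back : {mpoly K[N]} -> {mpoly K[#|U|]} := mmap (@mpolyC #|U| K)
    (fun j => if [pick i | @enum_val _ (mem U) i == j] is Some i then 'X_i else 0).
  suff <- : back (eval_at x F) = F by rewrite F0 /back mmap0.
  apply: (@mpoly_rmorph_ext _ _ _ (mmap (@mpolyC #|U| K) _ \o eval_at x) idfun) => [c|i] /=.
    by rewrite eval_atC mmapC.
  rewrite eval_atX mmap_var; case: pickP => [j /eqP/enum_val_inj->//|/(_ i)].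
  by rewrite eqxx.
- rewrite -[X in (X <= _)%N]card_ord -(cardsC U) leq_add2l.
  rewrite -[X in (_ <= X)%N](card_ord 3) -cardsT.
  apply: leq_trans (leq_imset_card v _); apply: subset_leq_card; apply/fintype.subsetP => j.
  by rewrite !inE negbK => /existsP[i /eqP <-]; apply: imset_f.
Qed.

(** * Generic links *)

Section Link.
Variables (K : fieldType) (N r : nat) (f : 'cV[{mpoly K[N]}]_r).
Local Notation S := {mpoly K[N]}.
Local Notation S' := {mpoly K[N + 3 * r]}.
Local Notation J := (ideal_gen (range (fun j => f j 0))).
Local Notation L := (@generic_link K N 3 r f).
Local Notation ext := (@extend_vars K N (3 * r)).
Local Notation alpha i := (link_gens 3 f i 0).
Local Notation y i j := (rshift N (mxvec_index i j) : 'I_(N + 3 * r)).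

HB.instance Definition _ := GRing.RMorphism.copy ext
  (comp_mpoly [tuple 'X_(lshift (3 * r) i) | i < N]).

Lemma extC c : ext c%:MP = c%:MP. Proof. exact: comp_mpolyC. Qed.
Lemma extX i : ext 'X_i = 'X_(lshift (3 * r) i).
Proof. by rewrite /extend_vars comp_mpolyXU -tnth_nth tnth_mktuple. Qed.

Lemma alphaE i : alpha i = \sum_j 'X_(y i j) * ext (f j 0).
Proof. by rewrite mxE; apply: eq_bigr => j _; rewrite !mxE. Qed.

Lemma link_alpha i : L (alpha i).
Proof.
move=> z _; apply: ideal_mulr; first exact: ideal_gen_ideal.
by apply: sub_ideal_gen; exists i.
Qed.

Lemma link_mul x j : L x -> ideal_gen (range (fun i => alpha i)) (x * ext (f j 0)).
Proof.
apply; apply: sub_ideal_gen; exists (f j 0) => //.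
by apply: sub_ideal_gen; exists j.
Qed.

Lemma mxvec_index_inj (i i' : 'I_3) (j j' : 'I_r) :
  (mxvec_index i j == mxvec_index i' j') = ((i == i') && (j == j')).
Proof. by rewrite (inj_eq (@cast_ord_inj _ _ _)) (inj_eq enum_rank_inj) xpair_eqE. Qed.

(** Regroups the ring as polynomials in the entries of [Y] over [S], so that extended elements
    become constants. *)
Definition split_ring : S' -> {mpoly S[3 * r]} :=
  mmap (@mpolyC (3 * r) S \o @mpolyC N K)
    (fun k => match split k with inl i => ('X_i)%:MP | inr k => 'X_k end).

HB.instance Definition _ := GRing.RMorphism.copy split_ring
  (mmap (@mpolyC (3 * r) S \o @mpolyC N K)
    (fun k => match split k with inl i => ('X_i)%:MP | inr k => 'X_k end)).

Lemma split_ring_ext x : split_ring (ext x) = x%:MP.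
Proof.
apply: (@mpoly_rmorph_ext _ _ _ (split_ring \o ext) (@mpolyC (3 * r) S)) => [c|i] /=.
  by rewrite extC; exact: mmapC.
by rewrite extX /split_ring mmap_var (unsplitK (inl i)).
Qed.

Lemma ext_inj x : ext x = 0 -> x = 0.
Proof.
by move=> x0; apply/eqP; rewrite -(mpolyC_eq0 (3 * r)) -split_ring_ext x0 rmorph0.
Qed.

Lemma split_ringK x : mmap ext (fun k => 'X_(rshift N k)) (split_ring x) = x.
Proof.
apply: (@mpoly_rmorph_ext _ _ _
  (mmap ext (fun k => 'X_(rshift N k) : S') \o split_ring) idfun) => [c|i] /=.
  by rewrite [split_ring _]mmapC mmapC /= extC.
rewrite /split_ring mmap_var; have := splitK i; case: split => k <-.
  by rewrite mmapC /= extX.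
by rewrite mmap_var.
Qed.

Lemma ext_free (V : pred 'I_(N + 3 * r)) x :
  (forall i, ~~ V (lshift _ i)) -> free_of V (ext x).
Proof.
move=> Vl; apply: (@mpoly_rmorph_ext _ _ _ (kill V \o ext) ext) => [c|i] /=.
  by rewrite extC killC.
by rewrite extX killX (negPf (Vl i)).
Qed.

Section Elim.
Variable j0 : 'I_r.
Hypothesis fj0 : f j0 0 != 0.
Let v i : 'I_(N + 3 * r) := y i j0.
Let s := ext (f j0 0).
Let rest i : S' := \sum_(j | j != j0) 'X_(y i j) * ext (f j 0).

Lemma alpha_elim i : alpha i = s * 'X_(v i) + rest i.
Proof. by rewrite alphaE (bigD1 j0) //= mulrC. Qed.

Let v_inj : injective v.
Proof. by move=> i i' /eqP; rewrite eq_rshift mxvec_index_inj eqxx andbT => /eqP. Qed.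

Let Fs : free_of [pred k | [exists i, v i == k]] s.
Proof. by apply: ext_free => i /=; apply/existsPn => i'; rewrite eq_rlshift. Qed.

Let Frest i : free_of [pred k | [exists i, v i == k]] (rest i).
Proof.
apply: (big_ind (free_of _)) => [|a b|j jj0]; [exact: free0 | exact: freeD | apply: freeM].
  apply: freeX; apply/existsPn => i'.
  by rewrite eq_rshift mxvec_index_inj negb_and [j0 == j]eq_sym jj0 orbT.
by apply: ext_free => i' /=; apply/existsPn => i''; rewrite eq_rlshift.
Qed.

Let s0 : s != 0.
Proof. by apply: contra_neq fj0 => /ext_inj. Qed.

(** The product of [f_j0] and [L] lies in the ideal of the [alpha i], hence in the kernel that
    eliminates column [j0] of [Y]. This kernel is prime and avoids [f_j0], so it contains [L]. *)
Lemma link_height_le3 : height_le3 L.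
Proof.
apply: (elim_height_le3 v_inj s0 Fs Frest) => x Lx.
case/prime_idealP: (ker_prime (elim_hom v s rest 3)) => kI _ kM.
have [|//|/eqP] := kM x s; last by rewrite (negPf (elim_hom_s rest s0 Fs 3)).
apply: (ideal_gen_min kI) (link_mul j0 Lx) => _ [i _ <-].
by rewrite alpha_elim /= elim_hom_eq // ltn_ord.
Qed.

Lemma link_chain_off P : prime_ideal P -> L `<=` P -> ~ P s -> hom_chain3 P.
Proof.
move=> PP LP Ps; apply: (elim_hom_chain3 v_inj Fs Frest PP Ps) => i.
by rewrite -alpha_elim; apply/LP/link_alpha.
Qed.

Lemma link_locally_3gen : locally_3gen L.
Proof.
exists [pred k : 'I_(N + 3 * r) | (N <= k)%N], s, (fun i => alpha i); split.
- have -> : kill [pred k : 'I_(N + 3 * r) | (N <= k)%N] s = s.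
    by apply: ext_free => i /=; rewrite -ltnNge.
  exact: s0.
- move=> i; rewrite alphaE rmorph_sum big1 // => j _.
  by rewrite rmorphM /= killX /= leq_addr mul0r.
- by move=> x /(link_mul j0); rewrite mulrC.
Qed.

End Elim.

(** If [P] misses some [f_j], column [j] of [Y] can be eliminated. Otherwise [P] contracts to a
    prime containing [J], and the kernels below the contraction extend coefficientwise to kernels
    below [P]; elements of [S] witness strictness. *)
Lemma link_height_ge3 : height_ge3 J -> height_ge3 L.
Proof.
move=> J3 P PP LP; have [[j Pj]|nPj] := pselect (exists j, ~ P (ext (f j 0))).
  exact: link_chain_off PP LP Pj.
have Pf j : P (ext (f j 0)) by apply: contrapT => ?; apply: nPj; exists j.
case/prime_idealP: (PP) => PI _ _.
have [D [h [h1 [h2 nh2]]]] : hom_chain3 [set x | P (ext x)].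
  apply: J3; first exact: prime_preim.
  by apply: ideal_gen_min; [exact: ideal_preim | move=> _ [j _ <-]].
exists {mpoly D[3 * r]}, (fun k => map_mpoly (h k) \o split_ring).
have sub i (Q : set S) x : ker_set (h i) `<=` Q ->
    ker_set (map_mpoly (h i) \o split_ring) x -> forall m, Q (split_ring x)@_m.
  move=> hQ x0 m; have {}x0 : map_mpoly (h i) (split_ring x) = 0 := x0.
  by apply: hQ; rewrite /ker_set /= -mcoeff_map_mpoly x0 mcoeff0.
split=> [i i2|].
  have [hi nhi] := h1 _ i2; split=> [x /(sub _ _ _ hi) x0|nx].
    by apply/mpolyP => m /=; rewrite mcoeff_map_mpoly mcoeff0; apply: x0.
  apply: nhi => x x0; have /nx : ker_set (map_mpoly (h i.+1) \o split_ring) (ext x).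
    by rewrite /ker_set /= split_ring_ext map_mpolyC; apply/eqP; rewrite mpolyC_eq0; exact/eqP.
  by rewrite /ker_set /= split_ring_ext map_mpolyC => /eqP; rewrite mpolyC_eq0 => /eqP.
split=> [x /(sub _ _ _ h2) x0|nx].
  rewrite -(split_ringK x) [split_ring x]mpolyE rmorph_sum; apply: ideal_sum => // m _.
  by rewrite -mul_mpolyC rmorphM /= mmapC; apply: ideal_mulr => //; exact: x0.
apply: nh2 => x /= Px; have := nx (ext x) Px.
by rewrite /ker_set /= split_ring_ext map_mpolyC => /eqP; rewrite mpolyC_eq0 => /eqP.
Qed.

Lemma degree_ext v x : degree_le (rshift N v) 0 (ext x).
Proof.
elim/mpoly_closure: x => [c|i|a b|a b]; rewrite ?rmorphD ?rmorphM.
- rewrite extC; exact: degree_leC.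
- move=> m; rewrite extX mcoeffX; case: (eqVneq _ m) => [<- _|]; last by rewrite eqxx.
  by rewrite mnm1E eq_lrshift.
- exact: degree_leD.
- exact: (@degree_leM _ _ _ 0 0).
Qed.

Lemma degree_alpha i i0 j0 : degree_le (y i0 j0) (i == i0) (alpha i).
Proof.
rewrite alphaE; apply: degree_le_sum => j.
rewrite -[X in degree_le _ X]addn0; apply: degree_leM; last exact: degree_ext.
move=> m; rewrite mcoeffX; case: (eqVneq _ m) => [<- _|]; last by rewrite eqxx.
by rewrite mnm1E eq_rshift mxvec_index_inj; case: (i == i0); rewrite /= ?leq_b1.
Qed.

(** Degrees in the entries of [Y] are below [q], so a large exponent must sit on a variable of the
    base ring, and this factor survives the substitution. *)
Lemma outbox_subst q (b : 'I_(3 * r) -> S) x :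
  outbox q x -> (forall k, degree_le (rshift N k) q.-1 x) -> (0 < q)%N ->
  outbox q (mmap (@mpolyC N K)
    (fun k => match split k with inl i => 'X_i | inr k => b k end) x).
Proof.
move=> Ox dx q0; rewrite [x]mpolyE rmorph_sum big_seq.
apply: ideal_sum => [|m]; first exact: outbox_ideal.
rewrite mcoeff_msupp => xm; have [k qk] := Ox m xm.
rewrite -mul_mpolyC rmorphM /= mmapX; apply: outboxM.
have [i kE] : exists i, k = lshift (3 * r) i.
  have := splitK k; case: (split k) => i ik; first by exists i.
  by have := dx i m xm; rewrite leqNgt prednK // (ik : rshift N i = k) qk.
rewrite /mmap1 (bigD1 k) //= kE (unsplitK (inl i)) mulrC; apply: outboxM.
by rewrite -kE -(subnK qk) exprD; apply: outboxM; exact: outboxXn.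
Qed.

Lemma link_fpt_ge3 p : prime p -> fpt_ge3 p J -> fpt_ge3 p L.
Proof.
move=> pp lo e; have [h [Jh nO]] := lo e; exists (fun i => alpha i).
split=> [i|Ox]; first exact: link_alpha.
have /choice[b bE] i := ideal_gen_range (Jh i).
(* The coefficients of the [h i] in terms of the [f j]: specializing [Y] to [B] turns [alpha i] into
   [h i]. *)
pose B : 'M[S]_(3, r) := \matrix_(i, j) b i j.
have q0 : (0 < p ^ e)%N by rewrite expn_gt0 prime_gt0.
have := @outbox_subst _ (fun k => mxvec B 0 k) _ Ox _ q0.
set phi := (fun k => match split k with _ => _ end).
rewrite rmorphXn rmorph_prod /= => Hb; apply: nO.
have betaE i : mmap (@mpolyC N K) phi (alpha i) = h i.
  rewrite alphaE rmorph_sum bE; apply: eq_bigr => j _.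
  rewrite rmorphM /= mmap_var {1}/phi (unsplitK (inr _)) mxvecE mxE; congr (_ * _).
  apply: (@mpoly_rmorph_ext _ _ _ (mmap (@mpolyC N K) phi \o ext) idfun) => [c|k] /=.
    by rewrite extC mmapC.
  by rewrite extX mmap_var /phi (unsplitK (inl k)).
rewrite (eq_bigr _ (fun i _ => betaE i)) in Hb.
apply: Hb => k; case/mxvec_indexP: k => i0 j0.
rewrite -[X in degree_le _ X]mul1n; apply: degree_leXn.
(* Row [i0] of [Y] occurs only in [alpha i0], so the product of the three has degree at most one in
   each entry. *)
apply: (@degree_le_weak _ _ _ (\sum_(i < 3) (i == i0))%N); last first.
  by apply: degree_le_prod => i; exact: degree_alpha.
by rewrite (bigD1 i0) //= eqxx big1 // => i /negPf ->.
Qed.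

End Link.

(** * Pfaffians *)

Lemma lift_perm_onto n (i j : 'I_n.+1) (s : 'S_n.+1) :
  s i = j -> exists s' : 'S_n, lift_perm i j s' = s.
Proof.
move=> sij; have nj k : j != s (lift i k) by rewrite -sij (inj_eq perm_inj) neq_lift.
pose g k := odflt k (unlift j (s (lift i k))).
have gE k : lift j (g k) = s (lift i k).
  by rewrite /g; case: unliftP (nj k) => [l ->//|->]; rewrite eqxx.
have g_inj : injective g.
  by move=> k l /(congr1 (lift j)); rewrite !gE => /perm_inj/lift_inj.
exists (perm g_inj); apply/permP => k; case: (unliftP i k) => [l|] ->.
  by rewrite lift_perm_lift permE gE.
by rewrite lift_perm_id.
Qed.

Lemma lift_perm_inj n (i j : 'I_n.+1) : injective (lift_perm i j).
Proof.
move=> s s' ss'; apply/permP => k; apply: (@lift_inj _ j).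
by rewrite -!(lift_perm_lift i) ss'.
Qed.

Lemma lift_perm_bij n (i j : 'I_n.+1) :
  {on [pred s : 'S_n.+1 | s i == j], bijective (lift_perm i j)}.
Proof.
exists (fun s : 'S_n.+1 => odflt 1%g [pick s' | lift_perm i j s' == s]) => [s _|s /eqP sij].
  by case: pickP => [s' /eqP/lift_perm_inj//|/(_ s)]; rewrite eqxx.
case: pickP => [s' /eqP//|nos]; have [s' s'E] := lift_perm_onto sij.
by have := nos s'; rewrite s'E eqxx.
Qed.

(** Increasing means [f i + k <= f (i + k)]. Starting at index zero this bounds [f i] from below,
    and running up to the last index it bounds [f i] from above. *)
Lemma homo_ord_id n (f : 'I_n -> 'I_n) : {homo f : i j / (i < j)%N} -> f =1 id.
Proof.
move=> f_homo; have grow (i : 'I_n) k (ik : (i + k < n)%N) : (f i + k <= f (Ordinal ik))%N.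
  elim: k ik => [|k IHk] ik.
    rewrite addn0 leq_eqVlt; apply/orP; left; apply/eqP; congr (val (f _)).
    by apply: val_inj; rewrite /= addn0.
  have ik' : (i + k < n)%N by rewrite (ltn_trans _ ik) // addnS.
  rewrite addnS (leq_ltn_trans (IHk ik')) //; apply: f_homo => /=.
  by rewrite addnS.
move=> i; apply/val_inj/eqP; rewrite /= eqn_leq; apply/andP; split.
  have ik : (i + (n.-1 - i) < n)%N.
    by rewrite subnKC; case: (n) i => [[]//|m] i //=; rewrite -ltnS.
  have := leq_ltn_trans (grow i _ ik) (ltn_ord _); have := ltn_ord i; lia.
have i0 : (0 < n)%N by case: (n) i => [[]|].
have ik : (Ordinal i0 + i < n)%N by rewrite add0n.
have := grow _ _ ik; have -> : Ordinal ik = i by exact: val_inj.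
exact: (leq_trans (leq_addl _ _)).
Qed.

Lemma even_ord_inj t : injective (@even_ord t).
Proof. by move=> i j /(congr1 val) /= /double_inj/val_inj. Qed.

Lemma odd_ord_inj t : injective (@odd_ord t).
Proof. by move=> i j /(congr1 val) [] /double_inj/val_inj. Qed.

Lemma even_odd_ord t (i j : 'I_t) : (even_ord i == odd_ord j) = false.
Proof. by apply/negP => /eqP/(congr1 (odd \o val)) /=; rewrite !odd_double. Qed.

Variant pair_ord_spec t : 'I_(t.*2) -> Type :=
| PairEven i : pair_ord_spec (even_ord i)
| PairOdd i : pair_ord_spec (odd_ord i).

Lemma pair_ordP t (x : 'I_(t.*2)) : pair_ord_spec x.
Proof.
have xt : (x./2 < t)%N.
  rewrite -ltn_double (leq_ltn_trans _ (ltn_ord x)) //.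
  by rewrite -[X in (_ <= X)%N]odd_double_half leq_addl.
case: (boolP (odd x)) => ox.
  have -> : x = odd_ord (Ordinal xt).
    by apply: val_inj; rewrite /= -[LHS]odd_double_half ox.
  exact: PairOdd.
have -> : x = even_ord (Ordinal xt).
  by apply: val_inj; rewrite /= -[LHS]odd_double_half (negPf ox).
exact: PairEven.
Qed.

(** * Perfect matchings as cosets of the block stabilizer *)

Section BlockGroup.
Variable t : nat.
Local Notation ev := (@even_ord t).
Local Notation od := (@odd_ord t).

Definition pair_flip i : 'S_(t.*2) := tperm (ev i) (od i).
Definition pair_swap i j : 'S_(t.*2) := (tperm (ev i) (ev j) * tperm (od i) (od j))%g.

(* The stabilizer of the blocks {2i, 2i+1}: each of its right cosets contains
   exactly one [matching_perm]. *)
Definition block_group : {group 'S_(t.*2)} :=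
  <<[set pair_flip i | i : 'I_t] :|: [set pair_swap ij.1 ij.2 | ij : 'I_t * 'I_t]>>%G.

Lemma pair_flip_even i j : pair_flip i (ev j) = if i == j then od j else ev j.
Proof.
rewrite /pair_flip; case: eqVneq => [->|ij]; first by rewrite tpermL.
by rewrite tpermD ?(inj_eq (@even_ord_inj _)) // eq_sym even_odd_ord.
Qed.

Lemma pair_flip_odd i j : pair_flip i (od j) = if i == j then ev j else od j.
Proof.
rewrite /pair_flip; case: eqVneq => [->|ij]; first by rewrite tpermR.
by rewrite tpermD ?(inj_eq (@odd_ord_inj _)) // even_odd_ord.
Qed.

Lemma pair_swap_even i j k : pair_swap i j (ev k) = ev (tperm i j k).
Proof.
rewrite permM -inj_tperm; last exact: even_ord_inj.
by rewrite [tperm (od i) (od j) _]tpermD // eq_sym even_odd_ord.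
Qed.

Lemma pair_swap_odd i j k : pair_swap i j (od k) = od (tperm i j k).
Proof.
rewrite permM [tperm (ev i) (ev j) _]tpermD ?even_odd_ord //.
by rewrite -inj_tperm //; exact: odd_ord_inj.
Qed.

Lemma block_groupS (G : {group 'S_(t.*2)}) :
  (forall i, pair_flip i \in G) -> (forall i j, pair_swap i j \in G) ->
  block_group \subset G.
Proof.
move=> Gf Gs; rewrite gen_subG; apply/fintype.subsetP => h.
by case/finset.setUP => /imsetP[i _ ->]; [exact: Gf | exact: Gs].
Qed.

Lemma pair_flip_in i : pair_flip i \in block_group.
Proof. by apply/mem_gen/finset.setUP; left; apply/imsetP; exists i. Qed.

Lemma pair_swap_in i j : pair_swap i j \in block_group.
Proof. by apply/mem_gen/finset.setUP; right; apply/imsetP; exists (i, j). Qed.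

Lemma block_group_half h (x : 'I_(t.*2)) : h \in block_group ->
  forall y : 'I_(t.*2), (x./2 == y./2) = ((h x)./2 == (h y)./2).
Proof.
pose G := [set h : 'S_(t.*2) | [forall x : 'I_(t.*2), forall y : 'I_(t.*2),
  (x./2 == y./2) == ((h x)./2 == (h y)./2)]]%SET.
have Gg : group_set G.
  apply/group_setP; split=> [|a b].
    by rewrite inE; apply/forallP => u; apply/forallP => w; rewrite !perm1.
  rewrite !inE => /forallP Ga /forallP Gb; apply/forallP => u; apply/forallP => w.
  rewrite !permM; have /forallP/(_ w)/eqP -> := Ga u.
  by have /forallP/(_ (a w))/eqP -> := Gb (a u).
have half_ev i : (ev i)./2 = i by rewrite /= doubleK.
have half_od i : (od i)./2 = i by rewrite /= uphalf_double.
suff /fintype.subsetP sub : block_group \subset Group Gg.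
  by move=> /sub; rewrite inE => /forallP/(_ x)/forallP xh y; apply: (eqP (xh y)).
apply: block_groupS => [i|i j]; rewrite inE; apply/forallP => u; apply/forallP => w.
  suff E (z : 'I_(t.*2)) : (pair_flip i z)./2 = z./2 by rewrite !E.
  case: (pair_ordP z) => k; rewrite ?pair_flip_even ?pair_flip_odd;
    by case: ifP => _; rewrite ?half_ev ?half_od.
suff E (z : 'I_(t.*2)) : exists2 k : 'I_t, z./2 = k & (pair_swap i j z)./2 = tperm i j k.
  have [k -> ->] := E u; have [l -> ->] := E w.
  by rewrite !(inj_eq val_inj) (inj_eq perm_inj).
by case: (pair_ordP z) => k; exists k; rewrite ?pair_swap_even ?pair_swap_odd ?half_ev ?half_od.
Qed.

Lemma matching_permP (s : 'S_(t.*2)) :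
  reflect ((forall i, s (ev i) < s (od i))%N /\
           (forall i j : 'I_t, (i < j)%N -> (s (ev i) < s (ev j))%N))
          (matching_perm s).
Proof.
apply: (iffP andP) => [[/forallP s1 /forallP s2]|[s1 s2]]; split=> //.
- by move=> i j ij; have /forallP/(_ j)/implyP := s2 i; apply.
- exact/forallP.
- by apply/forallP => i; apply/forallP => j; apply/implyP; apply: s2.
Qed.

(** [h] permutes the blocks. The order inside each pair excludes flips, so [h] acts through a map
    [f] on blocks; the order of the first elements makes [f] increasing, hence the identity. *)
Lemma matching_perm_unique h m :
  h \in block_group -> matching_perm m -> matching_perm (h * m)%g -> (h * m)%g = m.
Proof.
move=> hB /matching_permP[m1 m2] /matching_permP[hm1 hm2].
have hE i : exists l, h (ev i) = ev l /\ h (od i) = od l.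
  have : ((h (ev i))./2 == (h (od i))./2).
    by rewrite -(block_group_half (ev i) hB) /= doubleK uphalf_double.
  have := hm1 i; rewrite !permM.
  case: (pair_ordP (h (ev i))) (erefl (h (ev i))) => l el;
  case: (pair_ordP (h (od i))) (erefl (h (od i))) => l' ol;
    rewrite /= ?doubleK ?uphalf_double => + /eqP/val_inj ll'; rewrite ?{}ll' in el ol *.
  - by rewrite ltnn.
  - by exists l'.
  - by rewrite ltnNge ltnW.
  - by rewrite ltnn.
have [f fE] := choice hE.
have f_id : f =1 id.
  apply: homo_ord_id => i j ij; have := hm2 i j ij; rewrite !permM (fE i).1 (fE j).1.
  by apply: contraTT; rewrite -!leqNgt leq_eqVlt => /orP[/eqP/val_inj->//|/m2/ltnW].
apply/permP => x; rewrite permM; congr (m _).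
by case: (pair_ordP x) => i; rewrite ((fE i).1, (fE i).2) f_id.
Qed.

(* The matching permutation of a coset minimizes this weight. *)
Let mu (s : 'S_(t.*2)) := (\sum_(i < t) (t - i) * s (ev i))%N.

Definition matching_repr (s : 'S_(t.*2)) : 'S_(t.*2) :=
  ([arg min_(h < 1%g | h \in block_group) mu (h * s)%g] * s)%g.

Lemma matching_repr_in s : exists2 h, h \in block_group & matching_repr s = (h * s)%g.
Proof. by rewrite /matching_repr; case: arg_minnP => // h hB _; exists h. Qed.

(** Rearrangement: the weights [t - i] are positive and strictly decreasing. Comparing a minimizer
    with its flips orders each pair, and comparing it with its swaps orders the first elements. *)
Lemma matching_reprP s : matching_perm (matching_repr s).
Proof.
rewrite /matching_repr; case: arg_minnP => // h hB h_min.
have {}h_min g : g \in block_group -> (mu (h * s)%g <= mu (g * (h * s))%g)%N.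
  by move=> gB; rewrite mulgA; apply: h_min; rewrite groupM.
move: (h * s)%g h_min => {h hB} s' s'min; apply/matching_permP; split=> [i|i j ij].
  have /s'min := pair_flip_in i; rewrite /mu (bigD1 i) //= [X in (_ <= X)%N](bigD1 i) //=.
  rewrite permM pair_flip_even eqxx.
  rewrite [X in (_ <= _ + X)%N](eq_bigr (fun k : 'I_t => (t - k) * s' (ev k))%N).
    rewrite leq_add2r leq_pmul2l ?subn_gt0 // leq_eqVlt => /orP[/eqP/val_inj/perm_inj/eqP|//].
    by rewrite even_odd_ord.
  by move=> k ki; rewrite permM pair_flip_even eq_sym (negPf ki).
have ji : j != i by rewrite neq_ltn ij orbT.
have /s'min := pair_swap_in i j; rewrite /mu (bigD1 i) //= (bigD1 j) //=.
rewrite [X in (_ <= X)%N](bigD1 i) //= [X in (_ <= _ + X)%N](bigD1 j) //=.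
have sw k : (pair_swap i j * s')%g (ev k) = s' (ev (tperm i j k)).
  by rewrite permM pair_swap_even.
rewrite !sw tpermL tpermR.
rewrite [X in (_ <= _ + (_ + X))%N](eq_bigr (fun k : 'I_t => (t - k) * s' (ev k))%N); last first.
  by move=> k /andP[ki kj]; rewrite sw tpermD 1?eq_sym.
have ne : (s' (ev i) != s' (ev j) :> nat).
  by rewrite (inj_eq val_inj) (inj_eq perm_inj) (inj_eq (@even_ord_inj _)) eq_sym.
have : (t - j < t - i)%N by rewrite ltn_sub2l // (ltn_trans ij).
move: (t - i)%N (t - j)%N (\sum_(_ < _ | _) _)%N => c d X.
move: (nat_of_ord (s' (ev i))) (nat_of_ord (s' (ev j))) ne => a b.
move=> ab dc; rewrite !addnA leq_add2r ltn_neqAle ab leqNgt /= => le; apply/negP; nia.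
Qed.

Lemma matching_repr_fiber m : matching_perm m ->
  [set s | matching_repr s == m]%SET = (block_group :* m)%g.
Proof.
move=> mm; apply/setP => s; rewrite inE; apply/eqP/rcosetP => [<-|[h hB ->]].
  have [h hB ->] := matching_repr_in s; exists (h^-1)%g; first by rewrite groupV.
  by rewrite mulgA mulVg mul1g.
have [g gB E] := matching_repr_in (h * m)%g; rewrite E mulgA.
apply: matching_perm_unique => //; first by rewrite groupM.
by rewrite -mulgA -E matching_reprP.
Qed.

End BlockGroup.

Definition alternating (A : pzRingType) m (M : 'M[A]_m) : Prop :=
  (forall i, M i i = 0) /\ (forall i j, M j i = - M i j).

Lemma alternating_sub (A : pzRingType) m k (g : 'I_k -> 'I_m) (M : 'M[A]_m) :
  alternating M -> alternating (mxsub g g M).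
Proof. by case=> M0 Ma; split=> [i|i j]; rewrite !mxE. Qed.

(** * Pfaffians as sums over all permutations *)

Section PfaffianSum.
Variables (A : comNzRingType) (t : nat) (M : 'M[A]_(t.*2)).
Local Notation ev := (@even_ord t).
Local Notation od := (@odd_ord t).

Definition pf_term (s : 'S_(t.*2)) : A :=
  (-1) ^+ s * \prod_(i < t) M (s (ev i)) (s (od i)).

Hypothesis M_alt : alternating M.

Lemma pf_term_flip i s : pf_term (pair_flip i * s)%g = pf_term s.
Proof.
rewrite /pf_term odd_permM odd_tperm even_odd_ord addTb signrN mulNr -mulrN; congr (_ * _).
rewrite (bigD1 i) //= [in RHS](bigD1 i) //= !permM pair_flip_even pair_flip_odd eqxx.
rewrite (M_alt.2 (s (ev i))) mulNr opprK; congr (_ * _); apply: eq_bigr => j ji.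
by rewrite !permM pair_flip_even pair_flip_odd eq_sym (negPf ji).
Qed.

Lemma pf_term_swap i j s : pf_term (pair_swap i j * s)%g = pf_term s.
Proof.
rewrite /pf_term !odd_permM !odd_tperm (inj_eq (@even_ord_inj _)) (inj_eq (@odd_ord_inj _)).
rewrite addbb addFb; congr (_ * _); rewrite [RHS](reindex_inj (@perm_inj _ (tperm i j))) /=.
by apply: eq_bigr => k _; rewrite permM pair_swap_even permM pair_swap_odd.
Qed.

Lemma pf_term_block h s : h \in block_group t -> pf_term (h * s)%g = pf_term s.
Proof.
pose G := [set h : 'S_(t.*2) | [forall s, pf_term (h * s)%g == pf_term s]]%SET.
have Gg : group_set G.
  apply/group_setP; split=> [|a b]; first by rewrite inE; apply/forallP => u; rewrite mul1g.
  rewrite !inE => /forallP Ga /forallP Gb; apply/forallP => u.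
  by rewrite -mulgA (eqP (Ga _)) (eqP (Gb _)).
suff /fintype.subsetP sub : block_group t \subset Group Gg.
  by move=> /sub; rewrite inE => /forallP/(_ s)/eqP.
by apply: block_groupS => [i|i j]; rewrite inE; apply/forallP => u;
  rewrite ?pf_term_flip ?pf_term_swap.
Qed.

(** The permutations are grouped into right cosets of the block group: the term is constant on a
    coset, and each coset contains one matching permutation. *)
Lemma pf_sum : \sum_s pf_term s = pfaffian M *+ #|block_group t|.
Proof.
rewrite (partition_big (@matching_repr t) (@matching_perm t)) => [|s _]; last first.
  exact: matching_reprP.
rewrite -sumrMnl; apply: eq_bigr => m mm.
rewrite (eq_bigl (fun s => s \in (block_group t :* m)%g)) => [|s]; last first.
  by rewrite -matching_repr_fiber // inE.
rewrite -(card_rcoset _ m) -sumr_const; apply: eq_bigr => _ /rcosetP[h hB ->].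
exact: pf_term_block.
Qed.

End PfaffianSum.

Lemma map_pfaffian (A B : comNzRingType) (f : {rmorphism A -> B}) t (M : 'M[A]_(t.*2)) :
  f (pfaffian M) = pfaffian (map_mx f M).
Proof.
rewrite rmorph_sum; apply: eq_bigr => s _; rewrite rmorphM rmorph_sign rmorph_prod.
by congr (_ * _); apply: eq_bigr => i _; rewrite mxE.
Qed.

Section GenericAlternating.
Variable m : nat.

(** One variable for every ordered pair makes the matrix alternating by construction. With integer
    coefficients, nonzero integer multiples can be cancelled before specializing to any ring. *)
Definition generic_alt : 'M[{mpoly int[#|{: 'I_m * 'I_m}|]}]_m :=
  \matrix_(i, j) ('X_(enum_rank (i, j)) - 'X_(enum_rank (j, i))).

Lemma generic_altP : alternating generic_alt.
Proof. by split=> [i|i j]; rewrite !mxE ?subrr ?opprB. Qed.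

Lemma generic_alt_spec (A : comNzRingType) (M : 'M[A]_m) : alternating M ->
  exists f : {rmorphism {mpoly int[#|{: 'I_m * 'I_m}|]} -> A}, map_mx f generic_alt = M.
Proof.
case=> M0 Ma; exists (mmap intr (fun k : 'I_#|{: 'I_m * 'I_m}| => let ij := enum_val k in
  if (ij.1 < ij.2)%N then M ij.1 ij.2 else 0)).
apply/matrixP => i j; rewrite !mxE rmorphB /= !mmap_var !enum_rankK /=.
by case: ltngtP => [ij|ji|/val_inj ->]; rewrite ?subr0 ?sub0r ?subrr ?M0.
Qed.

Lemma mpoly_int_mulrn n (x : {mpoly int[n]}) k : (0 < k)%N -> x *+ k = 0 -> x = 0.
Proof.
move=> k0 /eqP; rewrite -mulr_natl mulf_eq0 => /orP[|/eqP//].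
by rewrite -mpolyC_nat mpolyC_eq0 pnatr_eq0 eqn0Ngt k0.
Qed.

End GenericAlternating.

(* Sums over all permutations compute pfaffians up to the order of the block
   group, so identities are proved over Z first. *)
Lemma pfaffian_perm (A : comNzRingType) t (s : 'S_(t.*2)) (M : 'M[A]_(t.*2)) :
  alternating M -> pfaffian (mxsub s s M) = (-1) ^+ s * pfaffian M.
Proof.
case/generic_alt_spec => f <-; have -> : mxsub s s (map_mx f (generic_alt _)) =
  map_mx f (mxsub s s (generic_alt _)) by apply/matrixP => i j; rewrite !mxE.
rewrite -!map_pfaffian -(rmorph_sign f) -rmorphM; congr (f _).
have alt := generic_altP (t.*2); set G := generic_alt _ in alt *.
apply/eqP; rewrite -subr_eq0; apply/eqP/(@mpoly_int_mulrn _ _ #|block_group t|).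
  by rewrite cardG_gt0.
rewrite mulrnBl -pf_sum; last exact: alternating_sub.
rewrite -mulrnAr -pf_sum // mulr_sumr [X in _ - X](reindex_inj (mulIg s)) /=.
rewrite -sumrB big1 // => u _; apply/eqP; rewrite subr_eq0; apply/eqP.
rewrite /pf_term odd_permM signr_addb [_ * (-1) ^+ s]mulrC -mulrA signrMK; congr (_ * _).
by apply: eq_bigr => i _; rewrite !mxE !permM.
Qed.

(* The sum over all permutations s of sgn(s) M_{i,s(0)} times the product of the
   M_{s(2k+1),s(2k+2)} vanishes: exchanging s(0) with the partner of i in s
   reverses the sign. *)
Lemma pfaffian_kernel (A : comNzRingType) t (M : 'M[A]_(t.*2.+1)) i :
  alternating M ->
  \sum_j M i j * ((-1) ^+ j * pfaffian (mxsub (lift j) (lift j) M)) = 0.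
Proof.
case/generic_alt_spec => f <-; set G := generic_alt _.
pose T : {mpoly int[_]} := \sum_j G i j * ((-1) ^+ j * pfaffian (mxsub (lift j) (lift j) G)).
suff T0 : T = 0.
  rewrite -[RHS](rmorph0 f) -T0 rmorph_sum; apply: eq_bigr => j _.
  rewrite !rmorphM rmorphXn rmorphN1 map_pfaffian mxE; congr (_ * (_ * pfaffian _)).
  by apply/matrixP => k l; rewrite !mxE.
have [G0 Ga] := generic_altP (t.*2.+1); rewrite -/G in G0 Ga.
pose ev k := lift ord0 (@even_ord t k); pose od k := lift ord0 (@odd_ord t k).
pose F (s : 'S_(t.*2.+1)) := (-1) ^+ s * (G i (s ord0) * \prod_(k < t) G (s (ev k)) (s (od k))).
(* Grouping by the value [j] at [ord0] leaves a permutation of the other indices; deleting [j]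
   accounts for the sign [(-1) ^+ j]. *)
have TF : T *+ #|block_group t| = \sum_s F s.
  rewrite [RHS](partition_big (fun s : 'S_(t.*2.+1) => s ord0) predT) //= -sumrMnl.
  apply: eq_bigr => j _; rewrite (reindex _ (lift_perm_bij ord0 j)) /=.
  rewrite -!mulrnAr -pf_sum; last exact/alternating_sub/generic_altP.
  rewrite mulrA mulr_sumr; apply: eq_big => [s|s _]; first by rewrite lift_perm_id eqxx.
  rewrite /F odd_lift_perm /= signr_addb signr_odd lift_perm_id /pf_term.
  rewrite !mulrA [G i j * _]mulrC -!mulrA; congr (_ * _); rewrite mulrCA; congr (_ * (_ * _)).
  by apply: eq_bigr => k _; rewrite !mxE !lift_perm_lift.
(* The factor 2 appears because the exchange only shows that each partial sum is its own
   negative. *)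
apply: (@mpoly_int_mulrn _ _ (#|block_group t| * 2)).
  by rewrite muln_gt0 cardG_gt0.
(* Permutations are sorted by the position [pos] where they take the value [i]. At [pos = ord0]
   every term contains [G i i = 0]; elsewhere the exchange applies. *)
rewrite mulrnA TF (partition_big (fun s : 'S_(t.*2.+1) => s^-1%g i) predT) //= -sumrMnl.
rewrite big1 // => pos _; rewrite mulr2n.
have posE (s : 'S_(t.*2.+1)) : (s^-1%g i == pos) = (s pos == i).
  by rewrite -(inj_eq (@perm_inj _ s)) permKV eq_sym.
rewrite (eq_bigl _ _ posE).
have anti pos' : pos' != ord0 -> pos' != pos -> pos != ord0 ->
    (forall s : 'S_(t.*2.+1), s pos = i -> F (tperm ord0 pos' * s)%g = - F s) ->
    \sum_(s : 'S_(t.*2.+1) | s pos == i) F s + \sum_(s : 'S_(t.*2.+1) | s pos == i) F s = 0.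
  move=> n1 n2 n3 FN; rewrite [X in X + _](reindex_inj (mulgI (tperm ord0 pos'))) /=.
  rewrite (eq_bigl (fun s : 'S_(t.*2.+1) => s pos == i)) => [|s]; last first.
    by rewrite permM tpermD // eq_sym.
  by rewrite -big_split big1 // => s /eqP/FN /= ->; rewrite addNr.
case: (unliftP ord0 pos) => [k|] posl; last first.
  by rewrite big1 ?addr0 // => s /eqP; rewrite /F posl => ->; rewrite G0 mul0r mulr0.
have evod k0 : (ev k0 == od k0) = false by rewrite (inj_eq (@lift_inj _ _)) even_odd_ord.
have fixE (a b : 'I_(t.*2)) (s : 'S_(t.*2.+1)) : a != b ->
    (tperm ord0 (lift ord0 b) * s)%g (lift ord0 a) = s (lift ord0 a).
  by move=> ab; rewrite permM tpermD ?neq_lift // (inj_eq (@lift_inj _ _)) eq_sym.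
have swapF k0 pos' (s : 'S_(t.*2.+1)) (b : 'I_(t.*2)) : pos' = lift ord0 b ->
    b = even_ord k0 \/ b = odd_ord k0 ->
    G i (s pos') * G ((tperm ord0 pos' * s)%g (ev k0)) ((tperm ord0 pos' * s)%g (od k0)) =
      G i (s ord0) * G (s (ev k0)) (s (od k0)) ->
    F (tperm ord0 pos' * s)%g = - F s.
  move=> -> bk E; rewrite /F odd_mul_tperm neq_lift signr_addb mulN1r !mulNr; congr (- (_ * _)).
  rewrite permM tpermL (bigD1 k0) //= [in RHS](bigD1 k0) //= !mulrA E; congr (_ * _).
  apply: eq_bigr => l lk; rewrite !fixE //.
    by case: bk => ->; rewrite ?(inj_eq (@odd_ord_inj _)) // eq_sym even_odd_ord.
  by case: bk => ->; rewrite ?(inj_eq (@even_ord_inj _)) // even_odd_ord.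
case: (pair_ordP k) posl => k0 posl.
  apply: (anti (od k0)) => [|||s si]; first by rewrite eq_sym neq_lift.
  - by rewrite posl eq_sym (evod k0).
  - by rewrite posl eq_sym neq_lift.
  apply: (swapF k0 _ s (odd_ord k0)) => //; first by right.
  have E1 : (tperm ord0 (od k0) * s)%g (od k0) = s ord0 by rewrite permM tpermR.
  have E2 : s (ev k0) = i by rewrite /ev -posl.
  by rewrite E1 fixE ?even_odd_ord // -/(ev k0) E2 mulrC.
apply: (anti (ev k0)) => [|||s si]; first by rewrite eq_sym neq_lift.
- by rewrite posl (evod k0).
- by rewrite posl eq_sym neq_lift.
apply: (swapF k0 _ s (even_ord k0)) => //; first by left.
have E1 : (tperm ord0 (ev k0) * s)%g (ev k0) = s ord0 by rewrite permM tpermR.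
have E2 : s (od k0) = i by rewrite /od -posl.
rewrite E1 fixE 1?eq_sym ?even_odd_ord // -/(od k0) E2.
by rewrite [in LHS]Ga [in RHS]Ga !mulNr mulrC.
Qed.

(** * Expansion of a pfaffian along its last two indices *)

Section LastPair.
Variables (A : comNzRingType) (t : nat).
Local Notation w := (fun k : 'I_(t.*2) => lift ord_max (lift ord_max k) : 'I_(t.+1.*2)).
Local Notation a := (lift ord_max ord_max : 'I_(t.+1.*2)).
Local Notation b := (ord_max : 'I_(t.+1.*2)).

(** The matchings in which [a] and [b] are not partners: a matching permutation can list the pair of
    [a] and [b] only in last position. *)
Definition pf_rest (M : 'M[A]_(t.+1.*2)) : A :=
  \sum_(s : 'S_(t.+1.*2) | matching_perm s && (s a != a)) pf_term M s.

Let wE k : w k = k :> nat. Proof. by rewrite !lift_max. Qed.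

Let aE : a = t.*2 :> nat. Proof. by rewrite lift_max. Qed.

Let ev_last : @even_ord t.+1 ord_max = a.
Proof. by apply: val_inj; rewrite [RHS]aE. Qed.

Let od_last : @odd_ord t.+1 ord_max = b.
Proof. exact: val_inj. Qed.

Let ev_wid i : @even_ord t.+1 (widen_ord (leqnSn t) i) = w (even_ord i).
Proof. by apply: val_inj; rewrite [RHS]wE. Qed.

Let od_wid i : @odd_ord t.+1 (widen_ord (leqnSn t) i) = w (odd_ord i).
Proof. by apply: val_inj; rewrite [RHS]wE. Qed.

Let lift2 (s : 'S_(t.*2)) : 'S_(t.+1.*2) := lift_perm ord_max ord_max (lift_perm ord_max ord_max s).

Let lift2w s k : lift2 s (w k) = w (s k).
Proof. by rewrite /lift2 !lift_perm_lift. Qed.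

Let lift2a s : lift2 s a = a.
Proof. by rewrite /lift2 lift_perm_lift lift_perm_id. Qed.

Let lift2b s : lift2 s b = b.
Proof. by rewrite /lift2 lift_perm_id. Qed.

Let matching_last (s : 'S_(t.+1.*2)) : matching_perm s -> s a = a -> s b = b.
Proof.
move=> /matching_permP[/(_ ord_max) + _] sa; rewrite ev_last od_last sa => sb.
apply: val_inj; apply/eqP; rewrite /= eqn_leq -ltnS ltn_ord.
by apply: leq_ltn_trans sb; rewrite aE.
Qed.

Let matching_lift2 s : matching_perm (lift2 s) = matching_perm s.
Proof.
have ord_last (i : 'I_t.+1) : i = ord_max \/ exists j, i = widen_ord (leqnSn t) j.
  have := ltn_ord i; rewrite ltnS leq_eqVlt => /orP[/eqP it|it].
    by left; apply: val_inj.
  by right; exists (Ordinal it); apply: val_inj.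
apply/matching_permP/matching_permP => -[s1 s2]; split.
- by move=> i; have := s1 (widen_ord (leqnSn t) i); rewrite ev_wid od_wid !lift2w !wE.
- move=> i j ij; have := s2 (widen_ord (leqnSn t) i) (widen_ord (leqnSn t) j) ij.
  by rewrite !ev_wid !lift2w !wE.
- move=> i; case: (ord_last i) => [->|[j ->]].
    by rewrite ev_last od_last lift2a lift2b aE.
  by rewrite ev_wid od_wid !lift2w !wE.
- move=> i j ij; case: (ord_last i) (ord_last j) => [iE|[i' iE]] [jE|[j' jE]]; subst.
  + by rewrite ltnn in ij.
  + by rewrite ltnNge (ltnW (ltn_ord j')) in ij.
  + by rewrite ev_wid ev_last lift2w lift2a wE aE.
  + by rewrite !ev_wid !lift2w !wE; apply: s2.
Qed.

Lemma pfaffian_last2 (M : 'M[A]_(t.+1.*2)) :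
  pfaffian M = M a b * pfaffian (mxsub w w M) + pf_rest M.
Proof.
rewrite {1}/pfaffian (bigID (fun s : 'S_(t.+1.*2) => s a == a)) /=; congr (_ + _).
rewrite (reindex_onto lift2 (fun s => odflt 1%g [pick s' | lift2 s' == s])) /=; last first.
  move=> s /andP[ms /eqP sa]; case: pickP => [s' /eqP//|nos].
  have [s1 s1E] := lift_perm_onto (matching_last ms sa).
  have s1max : s1 ord_max = ord_max.
    by apply: (@lift_inj _ ord_max); rewrite -(lift_perm_lift ord_max) s1E sa.
  have [s2 s2E] := lift_perm_onto s1max.
  by have := nos s2; rewrite /lift2 s2E s1E eqxx.
rewrite mulr_sumr; apply: eq_big => [s|s _].
  rewrite matching_lift2 lift2a eqxx andbT; case: pickP => [s'|/(_ s)]; last by rewrite eqxx.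
  by move=> /eqP/lift_perm_inj/lift_perm_inj ->; rewrite eqxx andbT.
rewrite mulrCA /lift2 !odd_lift_perm !addbb -/(lift2 s); congr (_ * _).
rewrite big_ord_recr /= ev_last od_last lift2a lift2b mulrC; congr (_ * _).
by apply: eq_bigr => i _; rewrite ev_wid od_wid !lift2w mxE.
Qed.

(** Applied to [kill], this shows that the remainder is free of the variable at position [(a, b)],
    so the pfaffian is linear in that variable. *)
Lemma pf_rest_fixed (f : {rmorphism A -> A}) (M : 'M[A]_(t.+1.*2)) :
  (forall k l : 'I_(t.+1.*2), (k < l)%N -> (k, l) != (a, b) -> f (M k l) = M k l) ->
  f (pf_rest M) = pf_rest M.
Proof.
move=> fM; rewrite rmorph_sum; apply: eq_bigr => s /andP[/matching_permP[s1 s2] sa].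
rewrite rmorphM rmorph_sign rmorph_prod; congr (_ * _); apply: eq_bigr => i _.
apply: fM => //; apply: contra sa; rewrite xpair_eqE => /andP[/eqP sia /eqP sib].
have [it|it] := leqP t i.
  have iE : i = ord_max by apply: val_inj; apply/eqP; rewrite eqn_leq it -ltnS ltn_ord.
  by rewrite -{1}ev_last -iE sia.
(* If this pair came earlier, both entries of the last pair would exceed [a], but only one index
   does. *)
have h2 := s2 i ord_max it; have h1 := s1 ord_max; rewrite sia aE in h2.
have h3 : (s (odd_ord ord_max) < t.*2.+2)%N := ltn_ord _.
by have := leq_ltn_trans (leq_ltn_trans h2 h1) h3; rewrite ltnn.
Qed.

End LastPair.

Lemma pfaffian_fixed (A : comNzRingType) (f : {rmorphism A -> A}) t (M : 'M[A]_(t.*2)) :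
  (forall k l : 'I_(t.*2), f (M k l) = M k l) -> f (pfaffian M) = pfaffian M.
Proof.
by move=> fM; rewrite map_pfaffian; congr pfaffian; apply/matrixP => k l; rewrite mxE.
Qed.

Lemma pfaffian_row0 (A : comNzRingType) t (M : 'M[A]_(t.*2)) x :
  (forall k, M k x = 0) -> (forall k, M x k = 0) -> pfaffian M = 0.
Proof.
move=> M1 M2; apply: big1 => s _.
suff [i ->] : exists i, \prod_(i < t) M (s (even_ord i)) (s (odd_ord i)) =
   0 * \prod_(j < t | j != i) M (s (even_ord j)) (s (odd_ord j)) by rewrite mul0r mulr0.
case: (pair_ordP (s^-1%g x)) (permKV s x) => i si; exists i; rewrite (bigD1 i) //= si.
  by rewrite M2.
by rewrite M1.
Qed.

Lemma pfaffian_order0 (A : comNzRingType) (M : 'M[A]_(0.*2)) : pfaffian M = 1.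
Proof.
rewrite /pfaffian (big_pred1 1%g) => [|s].
  by rewrite odd_perm1 big_ord0 mulr1.
rewrite /= [RHS](_ : _ = true); last by apply/eqP/permP => -[].
by apply/matching_permP; split=> -[].
Qed.

(* The columns come from the kernel vectors of M bordered by unit vectors. *)
Lemma pfaffian_left_inverse (A : comNzRingType) t (M : 'M[A]_(t.*2)) :
  alternating M -> exists U, U *m M = (pfaffian M)%:M.
Proof.
case=> M0 Ma.
pose N (k : 'I_(t.*2)) : 'M[A]_(t.*2.+1) := \matrix_(i, j)
  match unlift ord_max i, unlift ord_max j with
  | Some i, Some j => M i j
  | Some i, None => (i == k)%:R
  | None, Some j => - (j == k)%:R
  | None, None => 0
  end.
have Na k : alternating (N k).
  split=> [i|i j]; rewrite !mxE; first by case: unlift.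
  by case: (unlift ord_max i) => [i'|]; case: (unlift ord_max j) => [j'|]; rewrite ?oppr0 ?opprK.
pose U : 'M[A]_(t.*2) := \matrix_(j, k) ((-1) ^+ j * pfaffian
  (mxsub (lift (lift ord_max j)) (lift (lift ord_max j)) (N k))).
have MU : M *m U = - (pfaffian M)%:M.
  apply/matrixP => i k; have := pfaffian_kernel (lift ord_max i) (Na k).
  rewrite big_ord_recr /= => /eqP; rewrite addr_eq0 => /eqP E.
  rewrite !mxE; transitivity (- (N k (lift ord_max i) ord_max * ((-1) ^+ t.*2 *
      pfaffian (mxsub (lift ord_max) (lift ord_max) (N k))))).
    rewrite -E; apply: eq_bigr => j _; have -> : widen_ord (leqnSn _) j = lift ord_max j.
      by apply: val_inj; rewrite [RHS]lift_max.
    by rewrite !mxE !liftK.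
  rewrite mxE liftK unlift_none -signr_odd odd_double mul1r mulr_natl.
  congr (- (pfaffian _ *+ _)); apply/matrixP => x y.
  by rewrite !mxE !liftK.
exists (U^T).
apply: trmx_inj; rewrite trmx_mul trmxK tr_scalar_mx.
have -> : M^T = - M by apply/matrixP => i j; rewrite !mxE Ma.
by rewrite mulNmx MU opprK.
Qed.

(** * Submaximal pfaffians of the generic skew-symmetric matrix *)

Lemma mxsub_entry (A : Type) m n k l (f : 'I_k -> 'I_m) (g : 'I_l -> 'I_n)
  (M : 'M[A]_(m, n)) i j : mxsub f g M i j = M (f i) (g j).
Proof. by rewrite mxE. Qed.

Section SkewPfaffians.
Variables (K : fieldType) (m : nat).
Local Notation S := {mpoly K[#|skew_index m|]}.
Local Notation X := (skew_mx K m).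
Local Notation pair k := (val (enum_val (k : 'I_#|skew_index m|))).

Definition pf_of t (g : 'I_(t.*2) -> 'I_m) : S := pfaffian (mxsub g g X).

(** Appends [b] and then [c] to the enumeration [g]. Enumerations need not be increasing; reordering
    changes a pfaffian only by a sign. *)
Definition ext2 t (g : 'I_(t.*2) -> 'I_m) b c (k : 'I_(t.+1.*2)) : 'I_m :=
  oapp (fun k' => oapp g b (unlift ord_max k')) c (unlift ord_max k).

Definition pf_of_rest t (g : 'I_(t.*2) -> 'I_m) b c : S :=
  pf_rest (mxsub (ext2 g b c) (ext2 g b c) X).

Definition skew_rank (b c : 'I_m) (bc : (b < c)%N) : 'I_#|skew_index m| :=
  enum_rank (Sub (b, c) bc : skew_index m).

Lemma skew_rankK (b c : 'I_m) (bc : (b < c)%N) : pair (skew_rank bc) = (b, c).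
Proof. by rewrite /skew_rank enum_rankK. Qed.

Lemma skew_mx_alt : alternating X.
Proof. by split=> [i|i j]; rewrite !mxE ?subrr ?opprB. Qed.

Lemma skew_var_lt (b c : 'I_m) (bc : (b < c)%N) : skew_var K b c = 'X_(skew_rank bc).
Proof. by rewrite /skew_var insubT. Qed.

Lemma skew_var_ge (b c : 'I_m) : (c <= b)%N -> skew_var K b c = 0.
Proof. by move=> cb; rewrite /skew_var insubF //= ltnNge cb. Qed.

Lemma skew_mx_lt (b c : 'I_m) (bc : (b < c)%N) : X b c = 'X_(skew_rank bc).
Proof. by rewrite mxE skew_var_lt (skew_var_ge (ltnW bc)) subr0. Qed.

Lemma skew_free (V : pred 'I_#|skew_index m|) i j :
  (forall k, V k -> pair k != (i, j) /\ pair k != (j, i)) -> free_of V (X i j).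
Proof.
move=> Vn; rewrite mxE; have Fv a b : (forall k, V k -> pair k != (a, b)) ->
    free_of V (skew_var K a b).
  move=> Vab; case: (ltnP a b) => [ab|/skew_var_ge ->]; last exact: free0.
  rewrite (skew_var_lt ab); apply: freeX; apply/negP => /Vab.
  by rewrite skew_rankK eqxx.
by apply: freeD; [|apply: freeN]; apply: Fv => k /Vn[].
Qed.

Lemma skew_kill (V : pred 'I_#|skew_index m|) i j :
  (forall k, pair k = (i, j) \/ pair k = (j, i) -> V k) -> kill V (X i j) = 0.
Proof.
move=> Vij; rewrite mxE rmorphB /=; have kv a b : (forall k, pair k = (a, b) -> V k) ->
    kill V (skew_var K a b) = 0.
  move=> Vab; case: (ltnP a b) => [ab|/skew_var_ge ->]; last exact: rmorph0.
  by rewrite (skew_var_lt ab) killX Vab // skew_rankK.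
by rewrite !kv ?subr0 // => k kE; apply: Vij; [right|left].
Qed.

Lemma skew_mx_neq0 (i j : 'I_m) : i != j -> X i j != 0.
Proof.
have lt (a b : 'I_m) (ab : (a < b)%N) : X a b != 0 by rewrite skew_mx_lt -msize_poly_eq0 msizeX.
rewrite neq_ltn => /orP[/lt//|/lt ji].
by rewrite skew_mx_alt.2 oppr_eq0.
Qed.

Lemma pf_of_free (V : pred 'I_#|skew_index m|) t (g : 'I_(t.*2) -> 'I_m) :
  (forall k l, free_of V (X (g k) (g l))) -> free_of V (pf_of g).
Proof. by move=> Fg; apply: pfaffian_fixed => k l; rewrite mxsub_entry; exact: Fg. Qed.

Lemma eq_pf_of t (g g' : 'I_(t.*2) -> 'I_m) : g =1 g' -> pf_of g = pf_of g'.
Proof. by move=> gg'; congr pfaffian; apply/matrixP => i j; rewrite !mxE !gg'. Qed.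

Variant ext2_spec t (g : 'I_(t.*2) -> 'I_m) b c : 'I_(t.+1.*2) -> 'I_m -> Type :=
| Ext2Old k : ext2_spec g b c (lift ord_max (lift ord_max k)) (g k)
| Ext2Fst : ext2_spec g b c (lift ord_max ord_max) b
| Ext2Snd : ext2_spec g b c ord_max c.

Lemma ext2P t (g : 'I_(t.*2) -> 'I_m) b c k : ext2_spec g b c k (ext2 g b c k).
Proof.
rewrite /ext2; case: (unliftP ord_max k) => [k'|] -> /=; last exact: Ext2Snd.
by case: (unliftP ord_max k') => [k''|] -> /=; [exact: Ext2Old | exact: Ext2Fst].
Qed.

Lemma ext2_old t (g : 'I_(t.*2) -> 'I_m) b c k :
  ext2 g b c (lift ord_max (lift ord_max k)) = g k.
Proof. by rewrite /ext2 liftK /= liftK. Qed.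

Lemma ext2_fst t (g : 'I_(t.*2) -> 'I_m) b c : ext2 g b c (lift ord_max ord_max) = b.
Proof. by rewrite /ext2 liftK /= unlift_none. Qed.

Lemma ext2_snd t (g : 'I_(t.*2) -> 'I_m) b c : ext2 g b c ord_max = c.
Proof. by rewrite /ext2 unlift_none. Qed.

Lemma pf_of_ext2 t (g : 'I_(t.*2) -> 'I_m) b c :
  pf_of (ext2 g b c) = X b c * pf_of g + pf_of_rest g b c.
Proof.
rewrite /pf_of (@pfaffian_last2 _ t) mxsub_entry (ext2_fst g) (ext2_snd g).
suff -> : mxsub (fun k : 'I_(t.*2) => lift ord_max (lift ord_max k))
  (fun k : 'I_(t.*2) => lift ord_max (lift ord_max k))
  (mxsub (ext2 g b c) (ext2 g b c) X) = mxsub g g X by [].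
by apply/matrixP => i j; rewrite 3!mxsub_entry !(ext2_old g).
Qed.

Lemma pf_of_rest_free (V : pred 'I_#|skew_index m|) t (g : 'I_(t.*2) -> 'I_m) b c :
  (forall k l, free_of V (X (g k) (g l))) -> (forall k, free_of V (X (g k) b)) ->
  (forall k, free_of V (X (g k) c)) -> free_of V (pf_of_rest g b c).
Proof.
move=> Fg Fb Fc; apply: pf_rest_fixed => k l kl nab; rewrite mxsub_entry -/(free_of V _).
have wE (x : 'I_(t.*2)) : lift ord_max (lift ord_max x) = x :> nat by rewrite !lift_max.
have aE : lift ord_max (ord_max : 'I_(t.*2.+1)) = t.*2 :> nat by rewrite lift_max.
case: (ext2P g b c k) kl nab => [k'||]; case: (ext2P g b c l) => [l'||] //.
- by rewrite aE wE ltnNge ltnW.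
- by rewrite ltnn.
- by rewrite eqxx.
- by rewrite wE ltnNge ltnW // (leq_trans (ltn_ord l')) //= ltnW.
- by rewrite aE ltnNge ltnW.
- by rewrite ltnn.
Qed.

Lemma ext2_inj t (g : 'I_(t.*2) -> 'I_m) b c : injective g -> b != c ->
  (forall k, g k != b) -> (forall k, g k != c) -> injective (ext2 g b c).
Proof.
move=> g_inj bc gb gc k l.
by case: (ext2P g b c k) => [k'||]; case: (ext2P g b c l) => [l'||] // E;
  rewrite ?(g_inj _ _ E) //; move: bc; rewrite ?E ?eqxx //;
  [have := gb k' | have := gc k' | have := gb l' | have := gc l'];
  rewrite E eqxx.
Qed.

(** Induction, splitting off the last pair. Killing its variable removes the first summand and fixes
    the remainder. A zero sum would thus make the remainder zero, and then also the product of the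
    variable and the smaller pfaffian. *)
Lemma pf_of_neq0 t (g : 'I_(t.*2) -> 'I_m) : injective g -> pf_of g != 0.
Proof.
elim: t g => [|t IHt] g g_inj; first by rewrite /pf_of pfaffian_order0 oner_eq0.
pose a : 'I_(t.+1.*2) := lift ord_max ord_max; pose b : 'I_(t.+1.*2) := ord_max.
pose g' (k : 'I_(t.*2)) := g (lift ord_max (lift ord_max k)).
have -> : pf_of g = pf_of (ext2 g' (g a) (g b)).
  by apply: eq_pf_of => k; case: ext2P.
rewrite pf_of_ext2; have g'_inj : injective g' by move=> k l /g_inj/lift_inj/lift_inj.
have ab : g a != g b by rewrite (inj_eq g_inj) eq_sym neq_lift.
have g'a k : g' k != g a by rewrite (inj_eq g_inj) (inj_eq (@lift_inj _ _)) eq_sym neq_lift.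
have g'b k : g' k != g b by rewrite (inj_eq g_inj) eq_sym neq_lift.
pose V : pred 'I_#|skew_index m| := fun k =>
  (pair k == (g a, g b)) || (pair k == (g b, g a)).
apply: contra_neq (mulf_neq0 (skew_mx_neq0 ab) (IHt _ g'_inj)) => E.
suff rest0 : pf_of_rest g' (g a) (g b) = 0 by rewrite rest0 addr0 in E.
have Frest : free_of V (pf_of_rest g' (g a) (g b)).
  apply: pf_of_rest_free => [k l|k|k]; apply: skew_free => p; rewrite /V.
  - by case/orP => /eqP ->; rewrite !xpair_eqE ?[_ == g' k]eq_sym ?[_ == g' l]eq_sym;
      rewrite ?(negPf (g'a _)) ?(negPf (g'b _)) ?andbF.
  - by case/orP => /eqP ->; rewrite !xpair_eqE ?[_ == g' k]eq_sym;
      rewrite ?(negPf (g'a _)) ?(negPf (g'b _)) ?andbF.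
  - by case/orP => /eqP ->; rewrite !xpair_eqE ?[_ == g' k]eq_sym;
      rewrite ?(negPf (g'a _)) ?(negPf (g'b _)) ?andbF.
rewrite -Frest -[RHS](rmorph0 (kill V)) -E rmorphD rmorphM /= skew_kill ?mul0r ?add0r //.
by move=> k [] kE; rewrite /V kE eqxx ?orbT.
Qed.

End SkewPfaffians.

Lemma inj_lift_perm n (f : 'I_n -> 'I_n.+1) j :
  injective f -> (forall k, f k != j) -> exists s : 'S_n, f =1 lift j \o s.
Proof.
move=> f_inj fj; pose g k := odflt k (unlift j (f k)).
have gE k : lift j (g k) = f k.
  by rewrite /g; case: unliftP (fj k) => [l ->//|->]; rewrite eqxx.
have g_inj : injective g by move=> k l /(congr1 (lift j)); rewrite !gE => /f_inj.
by exists (perm g_inj) => k; rewrite /= permE gE.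
Qed.

Lemma inj_miss n (f : 'I_n -> 'I_n.+1) : exists j, forall k, f k != j.
Proof.
apply: contrapT => nex; have /choice[g fg] j : exists k, f k = j.
  apply: contrapT => nk; apply: nex; exists j => k.
  by apply/eqP => fkj; apply: nk; exists k.
have := leq_card g (can_inj fg); rewrite !card_ord ltnn.
by [].
Qed.

Lemma card_gt2_sorted n (A : {set 'I_n}) : (2 < #|A|)%N -> exists a b c,
  [/\ a \in A, b \in A & c \in A] /\ ((a < b) && (b < c))%N.
Proof.
have ltE (x y : 'I_n) : x != y -> (x < y)%N \/ (y < x)%N by rewrite neq_ltn => /orP.
case/card_gt2P => x [y [z [[xA yA zA] [/ltE xy /ltE yz /ltE zx]]]].
case: xy => xy; case: yz => yz; case: zx => zx.
- by have := ltn_trans (ltn_trans xy yz) zx; rewrite ltnn.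
- by exists x, y, z; rewrite xy yz.
- by exists z, x, y; rewrite zx xy.
- by exists x, z, y; rewrite zx yz.
- by exists y, z, x; rewrite yz zx.
- by exists y, x, z; rewrite xy zx.
- by exists z, y, x; rewrite yz xy.
- by have := ltn_trans (ltn_trans zx yz) xy; rewrite ltnn.
Qed.

Section SubmaximalPfaffians.
Variables (K : fieldType) (n : nat).
Local Notation m := n.*2.+1.
Local Notation X := (skew_mx K m).
Local Notation S := {mpoly K[#|skew_index m|]}.
Local Notation I := (pfaffian_ideal X n).
Local Notation pair k := (val (enum_val (k : 'I_#|skew_index m|))).
Local Notation sub_pf j := (@pf_of K m n (@lift m j)).

Lemma pf_of_sub_pf (f : 'I_(n.*2) -> 'I_m) j : injective f -> (forall k, f k != j) ->
  exists s : bool, pf_of K f = (-1) ^+ s * sub_pf j.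
Proof.
move=> f_inj fj; have [s fE] := inj_lift_perm f_inj fj.
exists (odd_perm s); rewrite (eq_pf_of _ fE) /pf_of -pfaffian_perm.
  by congr pfaffian; apply/matrixP => k l; rewrite !mxsub_entry.
exact/alternating_sub/skew_mx_alt.
Qed.

Lemma sub_pf_in j : I (sub_pf j).
Proof.
apply: sub_ideal_gen; exists (lift j); split=> // k l kl.
by rewrite /= /bump; case: leqP; case: leqP => /=; lia.
Qed.

Lemma pf_of_in (f : 'I_(n.*2) -> 'I_m) : injective f -> I (pf_of K f).
Proof.
move=> f_inj; have [j fj] := inj_miss f; have [s ->] := pf_of_sub_pf f_inj fj.
by case: (ideal_gen_ideal [set x | exists f : 'I_(n.*2) -> 'I_m,
  {homo f : i j / (i < j)%N} /\ x = pfaffian (mxsub f f X)]) => _ _; apply; exact: sub_pf_in.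
Qed.

Lemma pfaffian_ideal_min (J : set S) : is_ideal J -> (forall j, J (sub_pf j)) -> I `<=` J.
Proof.
move=> JI Jpf; apply: ideal_gen_min => // _ [f [f_homo ->]].
have f_inj : injective f.
  by move=> k l fkl; apply/val_inj; case: (ltngtP k l) => // /f_homo; rewrite fkl ltnn.
have [j fj] := inj_miss f; have [s E] := pf_of_sub_pf f_inj fj.
rewrite -/(pf_of K f) E; case: JI => _ _; apply; exact: Jpf.
Qed.

Section Triple.
Variables (t : nat) (g : 'I_(t.*2) -> 'I_m) (a b c : 'I_m).
Hypotheses (g_inj : injective g) (ab : (a < b)%N) (bc : (b < c)%N).
Hypotheses (ga : forall k, g k != a) (gb : forall k, g k != b) (gc : forall k, g k != c).

(** [triple_fst] and [triple_snd] list the pairs [(a, b)], [(a, c)], [(b, c)], whose variables are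
    to be eliminated. *)
Definition triple_fst (i : 'I_3) := tnth [tuple a; a; b] i.
Definition triple_snd (i : 'I_3) := tnth [tuple b; c; c] i.
Local Notation p := triple_fst.
Local Notation q := triple_snd.

Let pq i : (p i < q i)%N.
Proof.
case: i => [[|[|[|i]]] hi] //; rewrite /triple_fst /triple_snd !(tnth_nth a) //=.
exact: ltn_trans bc.
Qed.

Definition triple_var i := skew_rank (pq i).
Definition triple_rest i : S := pf_of_rest K g (p i) (q i).

Let gp k i : g k != p i.
Proof. by case: i => [[|[|[|i]]] hi] //; rewrite /triple_fst !(tnth_nth a). Qed.

Let gq k i : g k != q i.
Proof. by case: i => [[|[|[|i]]] hi] //; rewrite /triple_snd !(tnth_nth a). Qed.

Let W : pred 'I_#|skew_index m| := [pred j | [exists i, triple_var i == j]].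

Lemma triple_eq i : pf_of K g * 'X_(triple_var i) + triple_rest i = pf_of K (ext2 g (p i) (q i)).
Proof. by rewrite pf_of_ext2 skew_mx_lt mulrC. Qed.

Lemma triple_var_inj : injective triple_var.
Proof.
move=> i j /(congr1 (fun k => pair k)); rewrite !skew_rankK => -[pE qE].
have nab : a != b by rewrite neq_ltn ab.
have nbc : b != c by rewrite neq_ltn bc.
apply: val_inj; move: pE qE; rewrite /triple_fst /triple_snd !(tnth_nth a).
case: i => [[|[|[|i]]] hi] //; case: j => [[|[|[|j]]] hj] //= E1 E2; exfalso; move: nab nbc;
  by rewrite ?E1 ?E2 ?eqxx.
Qed.

Let WP k : W k -> exists i, pair k = (p i, q i).
Proof. by case/existsP => i /eqP <-; exists i; rewrite skew_rankK. Qed.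

Let Fg k x : free_of W (X (g k) x).
Proof.
apply: skew_free => l /WP[i ->]; rewrite !xpair_eqE ![_ == g k]eq_sym.
by rewrite (negPf (gp _ _)) (negPf (gq _ _)) ?andbF.
Qed.

Lemma triple_free : free_of W (pf_of K g).
Proof. by apply: pf_of_free. Qed.

Lemma triple_rest_free i : free_of W (triple_rest i).
Proof. by apply: pf_of_rest_free. Qed.

Lemma triple_inj i : injective (ext2 g (p i) (q i)).
Proof. by apply: ext2_inj => //; rewrite neq_ltn pq. Qed.

Lemma triple_kill (V : pred 'I_#|skew_index m|) i :
  (forall k, (pair k).2 = b \/ (pair k).2 = c \/ (pair k).1 = b \/ (pair k).1 = c -> V k) ->
  kill V (pf_of K g * 'X_(triple_var i) + triple_rest i) = 0.
Proof.
move=> Vbc; rewrite triple_eq /pf_of map_pfaffian.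
have qbc : q i = b \/ q i = c.
  by rewrite /triple_snd (tnth_nth a); case: i => [[|[|[|i]]] hi] //=; [left|right|right].
apply: (@pfaffian_row0 _ t.+1 _ (ord_max : 'I_(t.+1.*2))) => k;
  rewrite mxE mxsub_entry (ext2_snd g);
  by apply: skew_kill => l [] lE; apply: Vbc; rewrite lE /=; case: qbc; auto.
Qed.

End Triple.

(** For some [t < n] a pfaffian [s] of size [2t] lies outside [P] while all those of size [2t + 2]
    lie in [P]. At least three indices are left over; appending two of them at a time gives three
    elements [s v_i + r_i] of [P]. *)
Lemma pfaffian_ideal_height_ge3 : height_ge3 I.
Proof.
move=> P PP IP; pose Q k := exists g : 'I_(k.*2) -> 'I_m, injective g /\ ~ P (pf_of K g).
have [t [tn [g [g_inj Pg]] nQ]] : exists t, [/\ (t < n)%N, Q t & ~ Q t.+1].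
  apply: contrapT => nex; have Qall k : (k <= n)%N -> Q k.
    elim: k => [_|k IHk kn].
      exists (fun=> ord0); split=> [[]//|]; rewrite /pf_of pfaffian_order0.
      by case/prime_idealP: PP.
    by apply: contrapT => nQ; apply: nex; exists k; split=> //; apply: IHk; exact: ltnW.
  by have [g [g_inj]] := Qall n (leqnn n); apply; apply/IP/pf_of_in.
have [a [b [c [ab bc ga gb gc]]]] : exists a b c : 'I_m, [/\ (a < b)%N, (b < c)%N,
    forall k, g k != a, forall k, g k != b & forall k, g k != c].
  pose A := [set j | j \notin codom g]%SET.
  have notA j : j \in A -> forall k, g k != j.
    by rewrite inE => jA k; apply: contraNneq jA => <-; apply: codom_f.
  have [|a [b [c [[aA bA cA] /andP[ab bc]]]]] := @card_gt2_sorted _ A.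
    have : (#|codom g| + #|A| = m)%N by rewrite cardsE cardC card_ord.
    by rewrite card_codom // card_ord -!addnn; move: (#|A|) tn => w; lia.
  by exists a, b, c; split=> //; exact: notA.
apply: (elim_hom_chain3 (@triple_var_inj a b c ab bc) (triple_free ab bc ga gb gc)
  (triple_rest_free ab bc ga gb gc) PP Pg) => i.
rewrite triple_eq; apply: contrapT => nP; apply: nQ.
by exists (ext2 g (triple_fst a b i) (triple_snd b c i)); split=> //; apply: triple_inj.
Qed.

End SubmaximalPfaffians.

(** * Reduction to three generators after multiplication by a smaller pfaffian *)

Section LastTriple.
Variables (K : fieldType) (t : nat).
Local Notation m := (t.+1.*2.+1).
Local Notation X := (skew_mx K m).
Local Notation S := {mpoly K[#|skew_index m|]}.
Local Notation I := (pfaffian_ideal X t.+1).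
Local Notation pair k := (val (enum_val (k : 'I_#|skew_index m|))).
Local Notation sub_pf j := (@pf_of K m t.+1 (@lift m j)).

Let g (k : 'I_(t.*2)) : 'I_m :=
  widen_ord (leqnSn _) (widen_ord (leqnSn _) (widen_ord (leqnSn _) k)).
Let a : 'I_m := widen_ord (leqnSn _) (widen_ord (leqnSn _) ord_max).
Let b : 'I_m := widen_ord (leqnSn _) ord_max.
Let c : 'I_m := ord_max.

Let ab : (a < b)%N. Proof. exact: ltnSn. Qed.
Let bc : (b < c)%N. Proof. exact: ltnSn. Qed.
Let ga k : g k != a. Proof. by rewrite -val_eqE /= neq_ltn ltn_ord. Qed.
Let gb k : g k != b. Proof. by rewrite -val_eqE /= neq_ltn ltnW ?ltnS // ltnW. Qed.
Let gc k : g k != c. Proof. by rewrite -val_eqE /= neq_ltn !leqW. Qed.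
Let g_inj : injective g. Proof. by move=> k l /(congr1 val) /= /val_inj. Qed.

Local Notation s := (pf_of K g).
Local Notation e := (fun i => s * 'X_(triple_var ab bc i) + @triple_rest K t.+1 t g a b c i).

Let E : set S := ideal_gen (range e).
Let EI : is_ideal E. Proof. exact: ideal_gen_ideal. Qed.

Let E_miss j i : triple_fst a b i != j -> triple_snd b c i != j -> (forall k, g k != j) ->
  E (sub_pf j).
Proof.
move=> fj sj gj; have ext_inj := @triple_inj t.+1 t g a b c g_inj ab bc ga gb gc i.
have [|u Eu] := pf_of_sub_pf K ext_inj (j := j).
  by move=> k; case: ext2P.
rewrite -[sub_pf j]mul1r -(expr1n _ 2) -sqrrN exprS expr1.
have -> : sub_pf j = (-1) ^+ u * pf_of K (ext2 g (triple_fst a b i) (triple_snd b c i)).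
  by rewrite Eu signrMK.
rewrite -triple_eq; case: EI => _ _ EM; do 2 apply: (EM).
by apply: sub_ideal_gen; exists i.
Qed.

Let E_a : E (sub_pf a).
Proof.
apply: (E_miss (i := ord_max)) => //;
  by rewrite /triple_fst /triple_snd (tnth_nth a) /= neq_ltn ?ab ?(ltn_trans ab bc) orbT.
Qed.

Let E_b : E (sub_pf b).
Proof.
apply: (E_miss (i := Ordinal (isT : 1 < 3)%N)) => //;
  by rewrite /triple_fst /triple_snd (tnth_nth a) /= neq_ltn ?ab ?bc ?orbT.
Qed.

Let E_c : E (sub_pf c).
Proof.
apply: (E_miss (i := ord0)) => //;
  by rewrite /triple_fst /triple_snd (tnth_nth a) /= neq_ltn ?bc ?(ltn_trans ab bc).
Qed.

(** Row [g i] of the kernel relation expresses the part indexed by [g] through the entries at [a],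
    [b], [c], which lie in [E]. Multiplying by [U], which inverts the submatrix on [g] up to the
    factor [s], isolates [s] times each entry. *)
Lemma last_triple_mul x : I x -> E (s * x).
Proof.
case: (EI) => E0 ED EM; apply: (pfaffian_ideal_min (J := [set x | E (s * x)])) => [|j /=].
  split=> /= [|u v Eu Ev|u v Ev]; first by rewrite mulr0.
    by rewrite mulrDr; apply: ED.
  by rewrite mulrCA; apply: EM.
pose vd (j : 'I_m) := (-1) ^+ j * sub_pf j.
have -> : sub_pf j = (-1) ^+ j * vd j by rewrite /vd signrMK.
rewrite mulrCA; apply: (EM).
have tailE y1 y2 y3 : E (y1 * vd a + y2 * vd b + y3 * vd c).
  by rewrite /vd; do ![apply: (ED)]; do 2 apply: (EM).
have [U UM] := pfaffian_left_inverse (alternating_sub g (skew_mx_alt K m)).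
have jE : [\/ j = a, j = b, j = c | exists l, j = g l].
  have := ltn_ord j; rewrite ltnS leq_eqVlt => /orP[/eqP jc|].
    by constructor 3; apply: val_inj.
  rewrite ltnS leq_eqVlt => /orP[/eqP jb|]; first by constructor 2; apply: val_inj.
  rewrite ltnS leq_eqVlt => /orP[/eqP ja|jt]; first by constructor 1; apply: val_inj.
  by constructor 4; exists (Ordinal jt); apply: val_inj.
have Evd j' : E (sub_pf j') -> E (s * vd j') by move=> Ej; do 2 apply: (EM).
case: jE => [->|->|->|[l ->]]; [exact: Evd | exact: Evd | exact: Evd |].
have -> : s * vd (g l) = \sum_i U l i * \sum_k X (g i) (g k) * vd (g k).
  transitivity (\sum_k (U *m mxsub g g X) l k * vd (g k)).
    rewrite UM (bigD1 l) //= mxE eqxx mulr1n big1 ?addr0 // => k kl.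
    by rewrite mxE eq_sym (negPf kl) mulr0n mul0r.
  rewrite (eq_bigr (fun k => \sum_i U l i * (X (g i) (g k) * vd (g k)))) => [|k _].
    by rewrite exchange_big; apply: eq_bigr => i _; rewrite mulr_sumr.
  by rewrite mxE mulr_suml; apply: eq_bigr => i _; rewrite mxsub_entry -mulrA.
apply: ideal_sum => // i _; apply: (EM).
have := pfaffian_kernel (g i) (skew_mx_alt K m).
rewrite !big_ord_recr /= -!addrA => /eqP; rewrite addr_eq0 !addrA => /eqP ->.
by apply: idealN => //; exact: tailE.
Qed.

Lemma pfaffian_ideal_height_le3 : height_le3 I.
Proof.
have Fs := triple_free K ab bc ga gb gc; have Fr := triple_rest_free K ab bc ga gb gc.
apply: (elim_height_le3 (@triple_var_inj _ a b c ab bc) (pf_of_neq0 K g_inj) Fs Fr) => x Ix.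
have ker := ker_prime (elim_hom (triple_var ab bc) s (@triple_rest K t.+1 t g a b c) 3).
case/prime_idealP: (ker) => kI _ kM; have [|/eqP|//] := kM s x; last first.
  by rewrite (negPf (elim_hom_s _ (pf_of_neq0 K g_inj) Fs 3)).
apply: (ideal_gen_min kI) (last_triple_mul Ix) => _ [i _ <-] /=.
by rewrite elim_hom_eq ?ltn_ord // ?pf_of_neq0 //; exact: triple_var_inj.
Qed.

(** [V] collects the variables with an index among the last three; [s] involves only the first [2t]
    indices. *)
Lemma pfaffian_ideal_locally_3gen : locally_3gen I.
Proof.
pose V : pred 'I_#|skew_index m| := fun k => (t.*2 <= (pair k).1)%N || (t.*2 <= (pair k).2)%N.
exists V, s, e; split=> [|i|x /last_triple_mul//].
- have -> : kill V s = s.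
    apply: pf_of_free => k l; apply: skew_free => j; rewrite /V.
    move=> Vj; suff out x y : pair j != (g x, g y) by split; exact: out.
    apply: contraTneq Vj => ->; rewrite negb_or -!ltnNge /=.
    by rewrite (ltn_ord x) (ltn_ord y).
  exact: pf_of_neq0.
- apply: triple_kill => k; rewrite /V.
  have tb : (t.*2 <= b)%N by exact: leqnSn.
  have tc : (t.*2 <= c)%N by exact: leqW.
  by case=> [->|[->|[->|->]]]; rewrite ?tb ?tc ?orbT.
Qed.

End LastTriple.

(** * Lower bound for the pfaffian ideal *)

Section Windows.
Variables (K : fieldType) (n : nat).
Local Notation m := n.*2.+1.
Local Notation X := (skew_mx K m).
Local Notation S := {mpoly K[#|skew_index m|]}.
Local Notation pair k := (val (enum_val (k : 'I_#|skew_index m|))).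
Local Notation ix k := (inord k : 'I_m).

(* Enumerations of the window of indices n-t, ..., n+t without its first,
   middle and last element.  Each of the three pfaffians of a window contains
   one corner variable that the induction splits off. *)
Fixpoint window1 t : 'I_(t.*2) -> 'I_m :=
  if t is t'.+1 then ext2 (@window1 t') (ix (n - t')) (ix (n + t'.+1)) else fun=> ord0.
Fixpoint window2 t : 'I_(t.*2) -> 'I_m :=
  if t is t'.+1 then ext2 (@window2 t') (ix (n - t'.+1)) (ix (n + t'.+1)) else fun=> ord0.
Fixpoint window3 t : 'I_(t.*2) -> 'I_m :=
  if t is t'.+1 then ext2 (@window3 t') (ix (n - t'.+1)) (ix (n + t')) else fun=> ord0.

Let ixE k : (k <= n + n)%N -> ix k = k :> nat.
Proof. by move=> kn; rewrite inordK // ltnS -addnn. Qed.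

Lemma window1_bound t k : (t <= n)%N -> (n - t < @window1 t k <= n + t)%N.
Proof.
elim: t k => [[]//|t IHt] k tn /=; have {}IHt k' := IHt k' (ltnW tn).
by case: ext2P => [k'||]; rewrite ?ixE; try have := IHt k'; lia.
Qed.

Lemma window2_bound t k : (t <= n)%N -> (n - t <= @window2 t k <= n + t)%N.
Proof.
elim: t k => [[]//|t IHt] k tn /=; have {}IHt k' := IHt k' (ltnW tn).
by case: ext2P => [k'||]; rewrite ?ixE; try have := IHt k'; lia.
Qed.

Lemma window3_bound t k : (t <= n)%N -> (n - t <= @window3 t k < n + t)%N.
Proof.
elim: t k => [[]//|t IHt] k tn /=; have {}IHt k' := IHt k' (ltnW tn).
by case: ext2P => [k'||]; rewrite ?ixE; try have := IHt k'; lia.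
Qed.

Let neq_ix (i : 'I_m) k : (k <= n + n)%N -> (i != k :> nat) -> i != ix k.
Proof. by move=> kn; apply: contraNneq => ->; rewrite ixE. Qed.

Lemma window_inj t : (t <= n)%N ->
  [/\ injective (@window1 t), injective (@window2 t) & injective (@window3 t)].
Proof.
elim: t => [_|t IHt tn]; first by split=> -[].
have [i1 i2 i3] := IHt (ltnW tn).
have b1 k := @window1_bound t k (ltnW tn); have b2 k := @window2_bound t k (ltnW tn).
have b3 k := @window3_bound t k (ltnW tn).
have ne x y : (x < y <= n + n)%N -> ix x != ix y.
  by move=> xy; apply: neq_ix; rewrite ?ixE; lia.
split; apply: ext2_inj; rewrite ?ne //; try lia; move=> k.
- by apply: (@neq_ix (@window1 t k)); have := b1 k; lia.
- by apply: (@neq_ix (@window1 t k)); have := b1 k; lia.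
- by apply: (@neq_ix (@window2 t k)); have := b2 k; lia.
- by apply: (@neq_ix (@window2 t k)); have := b2 k; lia.
- by apply: (@neq_ix (@window3 t k)); have := b3 k; lia.
- by apply: (@neq_ix (@window3 t k)); have := b3 k; lia.
Qed.

Definition corner_var b c (bc : (b < c <= n + n)%N) : 'I_#|skew_index m|.
Proof.
apply: (@skew_rank _ (ix b) (ix c)); case/andP: bc => bc cn.
by rewrite !ixE // (leq_trans (ltnW bc)).
Defined.

Lemma corner_free1 t (g : 'I_(t.*2) -> 'I_m) b c (bc : (b < c <= n + n)%N) :
  (forall k, g k != b :> nat) \/ (forall k, g k != c :> nat) ->
  free_of (pred1 (corner_var bc)) (pf_of K g).
Proof.
move=> gbc; apply: pf_of_free => k l; apply: skew_free => _ /= /eqP ->.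
rewrite skew_rankK !xpair_eqE -!val_eqE /= !ixE; try lia.
by case: gbc => gb; have := gb k; have := gb l; lia.
Qed.

Lemma corner_split t (g : 'I_(t.*2) -> 'I_m) b c (bc : (b < c <= n + n)%N) q (z : S) :
  (0 < q)%N -> (forall k, g k != b :> nat) -> (forall k, g k != c :> nat) ->
  free_of (pred1 (corner_var bc)) z ->
  outbox q (pf_of K (ext2 g (ix b) (ix c)) ^+ q.-1 * z) -> outbox q (pf_of K g ^+ q.-1 * z).
Proof.
move=> q0 gb gc Fz; have bcn := bc; have bc' : (ix b < ix c)%N by rewrite !ixE; lia.
have -> : pf_of K (ext2 g (ix b) (ix c)) =
    'X_(corner_var bc) * pf_of K g + pf_of_rest K g (ix b) (ix c).
  rewrite pf_of_ext2 (skew_mx_lt K bc'); congr ('X_(enum_rank _) * _ + _); exact: val_inj.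
apply: outbox_corner => //; first by apply: corner_free1; left.
by apply: pf_of_rest_free => [k l|k|k]; apply: skew_free => _ /= /eqP ->;
  rewrite skew_rankK !xpair_eqE -!val_eqE /= !ixE; try lia;
  have := gb k; have := gc k; try have := gb l; lia.
Qed.

(** The order of splitting matters. The corner of [window2] goes first, as the other two pfaffians
    each miss one of its indices. With [window2] shrunk, the corner of [window1] is free to go, and
    then that of [window3]. *)
Lemma window_not_outbox q t : (0 < q)%N -> (t <= n)%N ->
  ~ outbox q ((pf_of K (@window1 t) * pf_of K (@window2 t) * pf_of K (@window3 t)) ^+ q.-1).
Proof.
move=> q0; elim: t => [_|t IHt tn].
  rewrite /pf_of !pfaffian_order0 !mulr1 expr1n => /(_ 0%MM); rewrite mcoeff1 eqxx oner_eq0.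
  by case=> // i; rewrite mnm0E leqNgt q0.
have b1 k := @window1_bound t k (ltnW tn); have b2 k := @window2_bound t k (ltnW tn).
have b3 k := @window3_bound t k (ltnW tn).
have c1 k := @window1_bound t.+1 k tn; have c3 k := @window3_bound t.+1 k tn.
have w2 : (n - t.+1 < n + t.+1 <= n + n)%N by lia.
have w1 : (n - t < n + t.+1 <= n + n)%N by lia.
have w3 : (n - t.+1 < n + t <= n + n)%N by lia.
move=> O; apply: (IHt (ltnW tn)); set r := q.-1.
pose P1 := pf_of K (@window1 t.+1); pose P3 := pf_of K (@window3 t.+1).
have {O} : outbox q (pf_of K (@window2 t.+1) ^+ r * (P1 ^+ r * P3 ^+ r)).
  by move: O; rewrite !exprMn -mulrA mulrCA.
move/(@corner_split _ (@window2 t) _ _ w2 _ _ q0) => O.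
have {O} : outbox q (P1 ^+ r * (pf_of K (@window2 t) ^+ r * P3 ^+ r)).
  rewrite mulrCA; apply: O => [k|k|]; try by have := b2 k; lia.
  apply: freeM; apply: freeXn; apply: corner_free1.
    by left=> k; have := c1 k; lia.
  by right=> k; have := c3 k; lia.
move/(@corner_split _ (@window1 t) _ _ w1 _ _ q0) => O.
have {O} : outbox q (P3 ^+ r * (pf_of K (@window1 t) ^+ r * pf_of K (@window2 t) ^+ r)).
  rewrite mulrC -mulrA; apply: O => [k|k|]; try by have := b1 k; lia.
  apply: freeM; apply: freeXn; apply: corner_free1; right=> k.
    by have := b2 k; lia.
  by have := c3 k; lia.
move/(@corner_split _ (@window3 t) _ _ w3 _ _ q0) => O.
rewrite !exprMn mulrC; apply: O => [k|k|]; try by have := b3 k; lia.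
apply: freeM; apply: freeXn; apply: corner_free1; left=> k.
  by have := b1 k; lia.
by have := b2 k; lia.
Qed.

Lemma pfaffian_ideal_fpt_ge3 p : prime p -> fpt_ge3 p (pfaffian_ideal X n).
Proof.
move=> pp e; have [i1 i2 i3] := window_inj (leqnn n).
exists (tnth [tuple pf_of K (@window1 n); pf_of K (@window2 n); pf_of K (@window3 n)]).
split=> [i|].
  by case: i => [[|[|[|i]]] hi] //; rewrite (tnth_nth 0) /=; exact: pf_of_in.
rewrite !big_ord_recl big_ord0 !(tnth_nth 0) /= mulr1 mulrA.
by apply: window_not_outbox; rewrite // expn_gt0 prime_gt0.
Qed.

End Windows.

(** * Threshold and height carried along the chain of links *)

Theorem corollary4p2 (R : realType) (K : fieldType) (p : nat)
    (hp : p \in [pchar K]) (n : nat) (hn : (0 < n)%N) :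
  (forall (k N : nat) (wt : measure N) (J : set {mpoly K[N]}),
     iterated_link (pfaffian_ideal (skew_mx K n.*2.+1) n) k wt J ->
     has_fpt p J (3%:R : R))
  /\ has_fpt p (pfaffian_ideal (skew_mx K n.*2.+1) n) (3%:R : R).
Proof.
have pp : prime p by case/andP: hp.
(* The threshold needs only the first two properties; the height bounds keep [g = 3] at every
   stage. *)
pose good N (J : set {mpoly K[N]}) :=
  [/\ fpt_ge3 p J, locally_3gen J, height_ge3 J & height_le3 J].
have goodI : good _ (pfaffian_ideal (skew_mx K n.*2.+1) n).
  case: n hn => // t _; split.
  - exact: pfaffian_ideal_fpt_ge3.
  - exact: pfaffian_ideal_locally_3gen.
  - exact: pfaffian_ideal_height_ge3.
  - exact: pfaffian_ideal_height_le3.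
set I := pfaffian_ideal _ _ in goodI *.
suff link k N (wt : measure N) J : iterated_link I k wt J -> good N J.
  split=> [k N wt J /link[lo up _ _]|]; first exact: has_fpt3.
  by case: goodI => lo up _ _; exact: has_fpt3.
elim=> [//|{}k {}N {}wt {}J g r f wt' _ [lo up ge le] hJ JE _ _ _ _].
have g3 := has_height_eq3 ge le hJ; subst g.
(* If all generators were zero, the [h i] would vanish. Taking [e = 1] makes the exponent [p - 1]
   positive, so their power would be zero and lie in the Frobenius power. *)
have [j fj] : exists j, f j 0 != 0.
  apply: contrapT => nf; have [h [Jh]] := lo 1%N; apply.
  have h0 i : h i = 0.
    have := Jh i; rewrite JE => /ideal_gen_range[b ->]; apply: big1 => j _.
    by case: (eqVneq (f j 0) 0) => [->|fj]; [rewrite mulr0 | case: nf; exists j].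
  rewrite big_ord_recl h0 mul0r expr0n.
  have -> : ((p ^ 1).-1 == 0)%N = false by rewrite expn1; case: (p) pp => [|[|]].
  by case: (outbox_ideal K N (p ^ 1)).
rewrite JE in lo ge; split.
- exact: link_fpt_ge3.
- exact: link_locally_3gen fj.
- exact: link_height_ge3.
- exact: link_height_le3 fj.
Qed.
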